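(* For any two mm-spaces $X_0,X_1$ which are not mm-isomorphic, there exists an uncountable family of $\square$-geodesics from $X_0$ to $X_1$ which are pairwise disjoint, in the sense that any two distinct geodesics of the family do not intersect anywhere except at the endpoints. In particular, every $\square$-geodesic branches everywhere.
   Context: An mm-space is a triple $(X,d_X,\mu_X)$ where $(X,d_X)$ is a complete separable metric space and $\mu_X$ is a Borel probability measure on $X$. Two mm-spaces $X,Y$ are mm-isomorphic if there is an isometry $f\colon \operatorname{supp}\mu_X\to\operatorname{supp}\mu_Y$ with $f_*\mu_X=\mu_Y$; $\mathcal{X}$ is the set of mm-isomorphism classes. A parameter of $X$ is a Borel map $\varphi\colon [0,1)\to X$ with $\varphi_*\mathcal{L}^1=\mu_X$. The box distance $\square(X,Y)$ is the infimum of $\varepsilon\ge 0$ such that there exist parameters $\varphi$ of $X$, $\psi$ of $Y$ and a Borel set $I_0\subset[0,1)$ with $\mathcal{L}^1(I_0)\ge 1-\varepsilon$ and $|d_X(\varphi(s),\varphi(t))-d_Y(\psi(s),\psi(t))|\le\varepsilon$ for all $s,t\in I_0$; it is a metric on $\mathcal{X}$. A $\square$-geodesic from $X_0$ to $X_1$ is a map $[0,1]\ni t\mapsto X_t\in\mathcal{X}$ with $\square(X_s,X_t)=|s-t|\,\square(X_0,X_1)$ for all $s,t$. *)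

(* Defs.v *)
From mathcomp Require Import all_boot all_order all_algebra.
From mathcomp Require Import all_classical all_reals all_analysis.

Set Implicit Arguments.
Unset Strict Implicit.
Unset Printing Implicit Defensive.
Import Order.TTheory GRing.Theory Num.Theory.
Local Open Scope classical_set_scope.
Local Open Scope ring_scope.

Definition d_open (R : realType) (T : Type) (d : T -> T -> R) (A : set T) : Prop :=
  forall x, A x -> exists2 r : R, 0 < r & forall y, d x y < r -> A y.

Definition d_borel (R : realType) (T : Type) (d : T -> T -> R) : set (set T) :=
  <<s [set A | d_open d A] >>.

Record mmspace (R : realType) := MMSpace {
  mm_car : Type;
  mm_d : mm_car -> mm_car -> R;
  mm_d_eq0 : forall x y, mm_d x y = 0 <-> x = y;
  mm_d_sym : forall x y, mm_d x y = mm_d y x;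
  mm_d_tri : forall x y z, mm_d x z <= mm_d x y + mm_d y z;
  mm_complete : forall u : nat -> mm_car,
    (forall e : R, 0 < e -> exists N, forall m n, (N <= m)%N -> (N <= n)%N ->
        mm_d (u m) (u n) < e) ->
    exists x, forall e : R, 0 < e -> exists N, forall n, (N <= n)%N -> mm_d (u n) x < e;
  mm_separable : exists s : nat -> mm_car,
    forall x (e : R), 0 < e -> exists n, mm_d x (s n) < e;
  mm_mu : set mm_car -> \bar R;
  mm_mu0 : mm_mu set0 = 0%E;
  mm_mu_ge0 : forall A, d_borel mm_d A -> (0 <= mm_mu A)%E;
  mm_mu_sigma_additive : forall F : nat -> set mm_car,
    (forall n, d_borel mm_d (F n)) -> trivIset setT F ->
    (fun n => \sum_(0 <= i < n) mm_mu (F i))%E @ \oo --> mm_mu (\bigcup_n F n);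
  mm_mu_setT : mm_mu setT = 1%E
}.

Arguments mm_car {R} _.
Arguments mm_d {R} _ _ _.
Arguments mm_mu {R} _ _.

Definition mm_borel (R : realType) (X : mmspace R) : set (set (mm_car X)) :=
  d_borel (mm_d X).

Definition mm_supp (R : realType) (X : mmspace R) : set (mm_car X) :=
  [set x | forall r : R, 0 < r -> (0 < mm_mu X [set y | (mm_d X x y < r)%R])%E].

Arguments mm_supp {R} X _.
Arguments mm_borel {R} X _.

(* mm-isomorphism: an isometry f : supp mu_X -> supp mu_Y with f_* mu_X = mu_Y
   (f is given as a map on X; only its restriction to supp mu_X matters). *)
Definition mm_iso (R : realType) (X Y : mmspace R) : Prop :=
  exists f : mm_car X -> mm_car Y,
    [/\ (forall x, mm_supp X x -> mm_supp Y (f x)),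
        (forall x y, mm_supp X x -> mm_supp X y -> mm_d Y (f x) (f y) = mm_d X x y) &
        (forall B, mm_borel Y B -> mm_mu X (mm_supp X `&` f @^-1` B) = mm_mu Y B)].

Definition mm_parameter (R : realType) (X : mmspace R) (phi : R -> mm_car X) : Prop :=
  (forall B, mm_borel X B -> measurable (`[0, 1[ `&` phi @^-1` B)) /\
  (forall B, mm_borel X B ->
     lebesgue_measure (`[0, 1[ `&` phi @^-1` B) = mm_mu X B).

Arguments mm_parameter {R} X phi.

Definition box_adm (R : realType) (X Y : mmspace R) : set R :=
  [set eps | 0 <= eps /\
    exists (phi : R -> mm_car X) (psi : R -> mm_car Y) (I0 : set R),
      [/\ mm_parameter X phi, mm_parameter Y psi,
          measurable I0 /\ I0 `<=` `[0, 1[,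
          ((1 - eps)%:E <= lebesgue_measure I0)%E &
          forall s t, I0 s -> I0 t ->
            `| mm_d X (phi s) (phi t) - mm_d Y (psi s) (psi t) | <= eps]].

Definition box (R : realType) (X Y : mmspace R) : R := inf (box_adm X Y).

(* A box-geodesic from X0 to X1, represented by a choice of representatives
   gam t (t in [0,1]); gam 0 and gam 1 must be mm-isomorphic to X0, X1. *)
Definition box_geodesic (R : realType) (X0 X1 : mmspace R) (gam : R -> mmspace R) : Prop :=
  mm_iso (gam 0) X0 /\ mm_iso (gam 1) X1 /\
  forall s t, 0 <= s <= 1 -> 0 <= t <= 1 ->
    box (gam s) (gam t) = `|s - t| * box X0 X1.

Definition geodesics_disjoint (R : realType) (g1 g2 : R -> mmspace R) : Prop :=
  forall s t, 0 < s < 1 -> 0 < t < 1 -> ~ mm_iso (g1 s) (g2 t).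

Definition branches_at (R : realType) (X0 X1 : mmspace R) (gam : R -> mmspace R) (t : R) : Prop :=
  exists gam' : R -> mmspace R,
    [/\ box_geodesic X0 X1 gam',
        (forall s, 0 <= s <= t -> mm_iso (gam s) (gam' s)) &
        (forall e : R, 0 < e -> exists2 s, t < s < t + e & s <= 1 /\ ~ mm_iso (gam s) (gam' s))].

(* Main.v *)
From HB Require Import structures.
Require Import Defs.
From mathcomp Require Import all_boot all_order all_algebra.
From mathcomp Require Import all_classical all_reals all_analysis.
From mathcomp Require Import ring lra.
Import Order.TTheory GRing.Theory Num.Theory.
Import numFieldNormedType.Exports.
Local Open Scope classical_set_scope.
Local Open Scope ring_scope.

Set Implicit Arguments.
Unset Strict Implicit.
Unset Printing Implicit Defensive.

(* Encode a coupling of [X] and [Y] by the codes of its points in countable partitions of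
   [X] and [Y] of mesh tending to 0. Since the marginals are fixed, the masses of finite
   code words form a tight family, so an ultrafilter limit of them exists and is realised
   on [0,1) by nested intervals. Carrying membership in the good set as one more letter of
   the code, one gets that the infimum in the box distance is attained (in particular
   parameters exist, and box = 0 forces an mm-isomorphism); applied to conditionally
   independent couplings over [Y], the same limit gives the triangle inequality.

   Let [D] be the box distance of [X0] and [X1], attained with distortion at most [D] on a
   set [S] whose complement [Rem] has measure in (0, D]. At time [t] the points of [S] carry
   the interpolated metric (1-t) d0 + t d1, a proportion 1-t of [Rem] still sits in [X0]
   and the rest already in [X1]; the three pieces are glued along [S] with gaps th t D and
   th (1-t) D, where 1/2 <= th <= 1. Distances between points that do not change side
   between two times are D-Lipschitz in time, whence a geodesic for every [th]. A larger
   [th] gives larger distances, strictly so between the two sides of [Rem]; comparing the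
   masses of balls, the spaces obtained at equal times for different [th] are therefore
   never mm-isomorphic, while at different times they are at different box distance from
   [X0]. Branching follows by continuing a geodesic after time [t] with two different
   members of this family. *)

(** * Metric measure spaces as measure spaces *)

(** The window for [th] comes from two opposite demands. Jumping from [S] to one side of [Rem] and
    back trades the metric of that side for the interpolated one; on [S] these differ by up to t D
    or (1-t) D, and the triangle inequality asks that twice the gap cover this, so [th >= 1/2]. The
    gap itself moves at speed th D, and a geodesic needs speed at most D, so [th <= 1]. The obstacle
    is that a gap and a route through [S] might together move at speed (1 + th) D; what saves the
    estimate is that whenever the gap grows, the route does not get longer. Between the two sides of
    [Rem] the gaps add up to th D at every time, and there different [th] are told apart. This needs
    [Rem] to have positive mass even when the optimal good set is full, so the good set is shrunk in
    that case. Along these paths only upper bounds on the box distance are constructed: the lower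
    bounds follow from the triangle inequality, because the path joins two spaces at distance D. *)

Section mm_basics.
Context {R : realType} (X : mmspace R).
Implicit Types (x y z : mm_car X).
Local Notation d := (mm_d X).

Lemma mm_dxx x : d x x = 0.
Proof. by apply/mm_d_eq0. Qed.

Lemma mm_d_ge0 x y : 0 <= d x y.
Proof. have := mm_d_tri x y x; rewrite mm_dxx (mm_d_sym y x); lra. Qed.

Lemma mm_d_tri4 a b u v : `|d a b - d u v| <= d a u + d b v.
Proof.
rewrite ler_norml; have := mm_d_tri a u b; have := mm_d_tri u v b.
have := mm_d_tri u a v; have := mm_d_tri a b v.
rewrite (mm_d_sym v b) (mm_d_sym u a); lra.
Qed.

Lemma mm_inhabited : exists x : mm_car X, True.
Proof.
apply: contrapT => H; have := mm_mu_setT X.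
have -> : [set: mm_car X] = set0 by rewrite -subset0 => x _; apply: H; exists x.
by rewrite mm_mu0 => /eqP; rewrite eq_sym onee_eq0.
Qed.

Lemma d_open_ball x r : d_open d [set y | d x y < r].
Proof.
move=> y /= xy; exists (r - d x y); first by rewrite subr_gt0.
by move=> z yz; have := mm_d_tri x y z => /=; lra.
Qed.

Lemma mm_borel_open B : d_open d B -> mm_borel X B.
Proof. exact: sub_sigma_algebra. Qed.

End mm_basics.

(** A copy of the carrier on which the Borel sets are registered as the canonical measurable
    structure. *)
Definition mm_sig (R : realType) (X : mmspace R) : Type := mm_car X.

HB.instance Definition _ R X := gen_eqMixin (@mm_sig R X).
HB.instance Definition _ R X := gen_choiceMixin (@mm_sig R X).
HB.instance Definition _ R X :=
  isPointed.Build (@mm_sig R X) (projT1 (cid (mm_inhabited X))).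
HB.instance Definition _ R (X : mmspace R) := @isMeasurable.Build
  (sigma_display [set A | d_open (mm_d X) A]) (@mm_sig R X)
  (mm_borel X) (@sigma_algebra0 _ setT _) (@sigma_algebraC _ _)
  (@sigma_algebra_bigcup _ setT _).

Section mm_measure.
Context {R : realType} (X : mmspace R).
Implicit Types (x y z : mm_car X).
Local Notation d := (mm_d X).

Lemma mm_borel_ind (P : set (mm_car X) -> Prop) :
  P setT -> (forall B, d_open d B -> P B) ->
  (forall B, mm_borel X B -> P B -> P (~` B)) ->
  (forall F : nat -> set (mm_car X), (forall n, mm_borel X (F n)) ->
    trivIset setT F -> (forall n, P (F n)) -> P (\bigcup_n F n)) ->
  forall B, mm_borel X B -> P B.
Proof.
move=> PT PO PC PU.
apply: (@dynkin_induction _ (mm_sig X) [set A | d_open d A] P) => //.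
move=> A B oA oB x [Ax Bx]; have [r r0 rA] := oA _ Ax; have [q q0 qB] := oB _ Bx.
exists (Num.min r q); first by rewrite lt_min r0.
by move=> y; rewrite lt_min => /andP[/rA ? /qB].
Qed.

(** [mm_mu] is constrained on Borel sets only, while a measure has to be nonnegative on every set;
    hence the value 0 elsewhere. *)
Definition mmeas (A : set (mm_sig X)) : \bar R :=
  if `[< mm_borel X A >] then mm_mu X A else 0%E.

Lemma mmeasE A : mm_borel X A -> mmeas A = mm_mu X A.
Proof. by rewrite /mmeas; case: asboolP. Qed.

Let mmeas0 : mmeas set0 = 0%E.
Proof. by rewrite /mmeas; case: asboolP; rewrite ?mm_mu0. Qed.

Let mmeas_ge0 A : (0 <= mmeas A)%E.
Proof. by rewrite /mmeas; case: asboolP => // ?; exact: mm_mu_ge0. Qed.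

Let mmeas_sigma_additive : semi_sigma_additive mmeas.
Proof.
move=> F mF tF mU; rewrite mmeasE//.
rewrite (_ : (fun n => _) = fun n => (\sum_(0 <= i < n) mm_mu X (F i))%E).
  exact: mm_mu_sigma_additive.
by apply/funext => n; apply: eq_bigr => i _; rewrite mmeasE//; exact: mF.
Qed.

HB.instance Definition _ := isMeasure.Build _ _ _ mmeas
  mmeas0 mmeas_ge0 mmeas_sigma_additive.

Lemma mmeas_setT : mmeas setT = 1%E.
Proof. by rewrite mmeasE ?mm_mu_setT//; exact: (@measurableT _ (mm_sig X)). Qed.

End mm_measure.

(** * Codes of points in countable Borel partitions *)

Section codes.
Context {R : realType} (X : mmspace R).
Implicit Types (x y : mm_car X).
Local Notation d := (mm_d X).

Definition dense_pt : nat -> mm_car X := projT1 (cid (mm_separable X)).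

Lemma dense_ptP x e : 0 < e -> exists n, d x (dense_pt n) < e.
Proof. exact: (projT2 (cid (mm_separable X))). Qed.

Definition mesh (k : nat) : R := 2^-1 ^+ k.

Lemma mesh_gt0 k : 0 < mesh k.
Proof. by rewrite exprn_gt0. Qed.

Lemma mesh_half k : mesh k.+1 = mesh k / 2.
Proof. by rewrite /mesh exprS mulrC. Qed.

Lemma mesh_small e : 0 < e -> exists k, mesh k < e.
Proof.
move=> e0; have := @cvg_expr R 2^-1.
rewrite ger0_norm// invf_lt1// ltr1n => /(_ isT)/cvgrPdist_lt/(_ e e0)[k _ H].
by exists k; have := H k (leqnn k); rewrite sub0r normrN ger0_norm// ltW// mesh_gt0.
Qed.

Lemma mesh_le k l : (k <= l)%N -> mesh l <= mesh k.
Proof. by move=> kl; rewrite /mesh ler_wiXn2l//; lra. Qed.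

Lemma mm_code_ex k x : exists i, `[< d x (dense_pt i) < mesh k >].
Proof. by have [n] := dense_ptP x (mesh_gt0 k); exists n; apply/asboolP. Qed.

Definition mm_code (k : nat) x : nat := ex_minn (mm_code_ex k x).

Lemma mm_codeP k x : d x (dense_pt (mm_code k x)) < mesh k.
Proof. by rewrite /mm_code; case: ex_minnP => i /asboolP. Qed.

Lemma mm_borel_code k i : mm_borel X [set x | mm_code k x = i].
Proof.
have -> : [set x | mm_code k x = i] = [set x | d x (dense_pt i) < mesh k] `&`
   ~` (\bigcup_(j < i) [set x | d x (dense_pt j) < mesh k]).
  apply/seteqP; split=> x /=.
    rewrite /mm_code; case: ex_minnP => n /asboolP nk nmin <-; split => // -[j /= jn] /asboolP/nmin.
    by rewrite leqNgt jn.
  rewrite /mm_code; case: ex_minnP => n /asboolP nk nmin [ik ij].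
  apply/eqP; rewrite eqn_leq nmin ?andbT; last exact/asboolP.
  by rewrite leqNgt; apply/negP => ni; apply: ij; exists n.
have mb j : @measurable _ (mm_sig X) [set x | d x (dense_pt j) < mesh k].
  rewrite (_ : [set x | _] = [set x | d (dense_pt j) x < mesh k]).
    by apply: (@mm_borel_open _ X); exact: d_open_ball.
  by apply/seteqP; split=> x /=; rewrite mm_d_sym.
apply: (@measurableI _ (mm_sig X)); first exact: mb.
apply: (@measurableC _ (mm_sig X)).
exact: (@bigcup_measurable _ (mm_sig X)).
Qed.

(** The factor 3 makes these events increase with [k]: consecutive centres are at most (1 + 1/2)
    [mesh k] apart, and 3/2 + 1/2 + 1 = 3. *)
Definition inner_code (B : set (mm_car X)) (k : nat) : set nat :=
  [set i | forall y, d y (dense_pt i) < 3 * mesh k -> B y].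

Lemma inner_code_preimage (T : Type) (f : T -> mm_car X) (a : nat -> T -> nat) B :
  (forall z k, d (f z) (dense_pt (a k z)) <= mesh k) -> d_open d B ->
  f @^-1` B = \bigcup_k [set z | inner_code B k (a k z)] /\
  {homo (fun k => [set z | inner_code B k (a k z)]) : m n / (m <= n)%N >-> m `<=` n}.
Proof.
move=> af oB; split.
  apply/seteqP; split=> z /=.
    move=> /oB[r r0 rB]; have [k kr] : exists k, mesh k < r / 4.
      by apply: mesh_small; lra.
    exists k => // y yk; apply: rB; have := af z k.
    have := mm_d_tri (f z) (dense_pt (a k z)) y; rewrite (mm_d_sym y) in yk.
    lra.
  by move=> [k _]; apply; have := af z k; have := mesh_gt0 k; lra.
apply: homo_leq; [by move=> A|by move=> A C E CA AE; exact: subset_trans AE|].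
move=> k z /= H y; rewrite mesh_half => yk; apply: H.
have := mm_d_tri y (dense_pt (a k.+1 z)) (dense_pt (a k z)).
have := mm_d_tri (dense_pt (a k.+1 z)) (f z) (dense_pt (a k z)).
have := af z k; have := af z k.+1.
rewrite mesh_half (mm_d_sym (dense_pt (a k.+1 z)) (f z)); lra.
Qed.

End codes.

Lemma measurable_code d (T : measurableType d) (a : T -> nat) :
  (forall i, measurable [set z | a z = i]) ->
  forall J : set nat, measurable [set z | J (a z)].
Proof.
move=> ma J; have -> : [set z | J (a z)] = \bigcup_(i in J) [set z | a z = i].
  by apply/seteqP; split => z /=; [exists (a z)|case=> i Ji /= ->].
exact: bigcup_measurable.
Qed.

Lemma measure_code_le (R : realType) d1 d2 (T1 : measurableType d1)
    (T2 : measurableType d2) (m1 : {measure set T1 -> \bar R})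
    (m2 : {measure set T2 -> \bar R}) (a1 : T1 -> nat) (a2 : T2 -> nat) :
  (forall i, measurable [set z | a1 z = i]) ->
  (forall i, measurable [set z | a2 z = i]) ->
  (forall i, m1 [set z | a1 z = i] <= m2 [set z | a2 z = i])%E ->
  forall J : set nat, (m1 [set z | J (a1 z)] <= m2 [set z | J (a2 z)])%E.
Proof.
move=> ma1 ma2 a12 J.
have E (T : Type) (a : T -> nat) :
    [set z | J (a z)] = \bigcup_i ([set z | a z = i] `&` [set z | J i]).
  by apply/seteqP; split => z /=; [exists (a z)|case=> i _ [/= <-]].
have tr (T : Type) (a : T -> nat) :
    trivIset setT (fun i => [set z | a z = i] `&` [set z | J i]).
  by move=> i j _ _ [z /= [[<- _] [<- _]]].
have mI d (T : measurableType d) (a : T -> nat) i : measurable [set z | a z = i] ->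
    measurable ([set z | a z = i] `&` [set z | J i]).
  move=> mai; apply: measurableI => //.
  have [Ji|nJi] := pselect (J i).
    by rewrite (_ : [set z | J i] = setT)//; apply/seteqP; split.
  by rewrite (_ : [set z | J i] = set0)//; apply/seteqP; split.
rewrite (E T1) (E T2) !measure_bigcup//; last 2 first.
- by move=> i _; exact: mI.
- by move=> i _; exact: mI.
apply: lee_nneseries => // i _.
have [Ji|nJi] := pselect (J i).
  have K T : [set z : T | J i] = setT by apply/seteqP; split.
  by rewrite !K !setIT.
have K T : [set z : T | J i] = set0 by apply/seteqP; split.
by rewrite !K !setI0 !measure0.
Qed.

(** The preimage of an open set is an increasing union of events read off the codes, so the laws of
    the codes determine the law. Measurability of [f1] and [f2] is a conclusion, and the codes are
    only asked for weak inequalities, since limits of coded points satisfy no more. *)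
Lemma code_law_eq (R : realType) (X : mmspace R) d1 d2 (T1 : measurableType d1)
    (T2 : measurableType d2) (m1 : {measure set T1 -> \bar R})
    (m2 : {measure set T2 -> \bar R})
    (f1 : T1 -> mm_car X) (f2 : T2 -> mm_car X)
    (a1 : nat -> T1 -> nat) (a2 : nat -> T2 -> nat) :
  m1 setT = 1%E -> m2 setT = 1%E ->
  (forall z k, mm_d X (f1 z) (dense_pt X (a1 k z)) <= mesh k) ->
  (forall z k, mm_d X (f2 z) (dense_pt X (a2 k z)) <= mesh k) ->
  (forall k i, measurable [set z | a1 k z = i]) ->
  (forall k i, measurable [set z | a2 k z = i]) ->
  (forall k i, m1 [set z | a1 k z = i] = m2 [set z | a2 k z = i]) ->
  forall B, mm_borel X B ->
    [/\ measurable (f1 @^-1` B), measurable (f2 @^-1` B) &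
        m1 (f1 @^-1` B) = m2 (f2 @^-1` B)].
Proof.
move=> m1T m2T af1 af2 ma1 ma2 a12; apply: mm_borel_ind.
- by rewrite !preimage_setT m1T m2T.
- move=> B oB.
  have [E1 h1] := inner_code_preimage af1 oB.
  have [E2 h2] := inner_code_preimage af2 oB.
  have mm1 k : measurable [set z | inner_code B k (a1 k z)].
    exact: measurable_code (ma1 k) _.
  have mm2 k : measurable [set z | inner_code B k (a2 k z)].
    exact: measurable_code (ma2 k) _.
  have M1 : measurable (f1 @^-1` B) by rewrite E1; exact: bigcupT_measurable.
  have M2 : measurable (f2 @^-1` B) by rewrite E2; exact: bigcupT_measurable.
  split => //.
  have C1 : m1 [set z | inner_code B k (a1 k z)] @[k --> \oo] --> m1 (f1 @^-1` B).
    rewrite E1; apply: nondecreasing_cvg_mu => //; first by rewrite -E1.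
    by move=> k l kl; apply/subsetPset; exact: h1.
  have C2 : m2 [set z | inner_code B k (a2 k z)] @[k --> \oo] --> m2 (f2 @^-1` B).
    rewrite E2; apply: nondecreasing_cvg_mu => //; first by rewrite -E2.
    by move=> k l kl; apply/subsetPset; exact: h2.
  rewrite (_ : (fun k => m1 _) = (fun k => m2 [set z | inner_code B k (a2 k z)])) in C1.
    by rewrite -(cvg_lim _ C1)// -(cvg_lim _ C2).
  apply/funext => k; apply/eqP; rewrite eq_le.
  by apply/andP; split; apply: measure_code_le => // i; rewrite a12.
- move=> B _ [M1 M2 E].
  rewrite -!preimage_setC; split; [exact: measurableC|exact: measurableC|].
  have mC d (T : measurableType d) (m : {measure set T -> \bar R}) (A : set T) :
      m setT = 1%E -> measurable A -> m (~` A) = (1 - m A)%E.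
    move=> mT mA; rewrite -setTD -mT -[in RHS](setTI A).
    by apply: measureD => //; rewrite -ge0_fin_numE//; exact: (etrans (congr1 _ mT)).
  by rewrite !mC// E.
- move=> F _ tF IH; have pU (T : Type) (f : T -> mm_car X) :
    f @^-1` (\bigcup_n F n) = \bigcup_n f @^-1` F n by rewrite preimage_bigcup.
  rewrite !pU.
  have M1 i : measurable (f1 @^-1` F i) by have [] := IH i.
  have M2 i : measurable (f2 @^-1` F i) by have [] := IH i.
  split; [exact: bigcupT_measurable|exact: bigcupT_measurable|].
  have tp (T : Type) (f : T -> mm_car X) : trivIset setT (fun i => f @^-1` F i).
    by move=> i j Ti Tj [z [/= zi zj]]; apply: (tF i j Ti Tj); exists (f z).
  rewrite !measure_bigcup//.
  by apply: eq_eseriesr => i _; have [] := IH i.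
Qed.

(** * Realising tree weights on the unit interval *)

(** Words are stored last letter first, so that prolonging a word is a [cons] and tree weights
    recurse on the head. *)
Fixpoint rev_prefix (a : nat -> nat) (k : nat) : seq nat :=
  if k is k'.+1 then a k' :: rev_prefix a k' else [::].

Lemma size_rev_prefix a k : size (rev_prefix a k) = k.
Proof. by elim: k => //= k ->. Qed.

Lemma rev_prefix_inj a b k : rev_prefix a k = rev_prefix b k ->
  forall i, (i < k)%N -> a i = b i.
Proof.
elim: k => // k IH /= [ab /IH H] i; rewrite ltnS leq_eqVlt => /orP[/eqP ->//|].
exact: H.
Qed.

Section unit_interval.
Context {R : realType}.

Lemma measurable_unit : measurable (`[0, 1[%classic : set (measurableTypeR R)).
Proof. exact: measurable_itv. Qed.

Definition lebU : {measure set (measurableTypeR R) -> \bar R} :=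
  mrestr (@lebesgue_measure R) measurable_unit.

Lemma lebUE A : lebU A = lebesgue_measure (`[0, 1[ `&` A).
Proof. by rewrite /lebU /= /mrestr setIC. Qed.

Lemma lebU_setT : lebU setT = 1%E.
Proof.
by rewrite lebUE setIT lebesgue_measure_itv /= lte_fin ltr01 oppr0 adde0.
Qed.

End unit_interval.

Section tree_realization.
Context {R : realType} (P : seq nat -> R).
Hypothesis P_nil : P [::] = 1.
Hypothesis P_ge0 : forall w, 0 <= P w.
Hypothesis P_sum : forall w, \sum_(0 <= i < n) P (i :: w) @[n --> \oo] --> P w.

Fixpoint cell_left (w : seq nat) : R :=
  if w is j :: w' then cell_left w' + \sum_(0 <= i < j) P (i :: w') else 0.

Definition cell (w : seq nat) : set R :=
  [set s | cell_left w <= s < cell_left w + P w].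

Lemma P_sum_nd w : nondecreasing_seq (fun n => \sum_(0 <= i < n) P (i :: w)).
Proof. by apply/nondecreasing_seqP => n; rewrite big_nat_recr//= lerDl. Qed.

Lemma P_sum_le w n : \sum_(0 <= i < n) P (i :: w) <= P w.
Proof.
rewrite -(cvg_lim _ (P_sum (w := w)))//.
apply: nondecreasing_cvgn_le; first exact: P_sum_nd.
by apply/cvg_ex; exists (P w); exact: P_sum.
Qed.

Lemma cell_sub j w : cell (j :: w) `<=` cell w.
Proof.
move=> s /= /andP[ls sl]; apply/andP; split.
  by apply: le_trans ls; rewrite lerDl sumr_ge0.
apply: lt_le_trans sl _; rewrite -addrA lerD2l.
by have := P_sum_le w j.+1; rewrite big_nat_recr.
Qed.

(** The masses of the children exhaust [P w], so some partial sum passes [s - cell_left w]; the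
    first one to do so names the child. *)
Lemma cell_child w s : cell w s -> exists j, cell (j :: w) s.
Proof.
move=> /= /andP[ls sl].
have [n] : exists n, s - cell_left w < \sum_(0 <= i < n) P (i :: w).
  have /cvgrPdist_lt := P_sum (w := w).
  move=> /(_ (cell_left w + P w - s)); rewrite subr_gt0 => /(_ sl)[n _ /(_ n (leqnn n))].
  move=> /= /ltr_normlW H; exists n.
  have {}H : P w - \sum_(0 <= i < n) P (i :: w) < cell_left w + P w - s := H.
  lra.
elim: n => [|n IH]; first by rewrite big_geq// ; rewrite subr_lt0 ltNge ls.
have [/IH//|nl] := ltP (s - cell_left w) (\sum_(0 <= i < n) P (i :: w)).
rewrite big_nat_recr//= => H; exists n; rewrite /cell/=.
move: H nl; set S := bigop _ _ _ => H nl.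
by apply/andP; split; lra.
Qed.

Lemma cell_child_uniq w i j s : cell (i :: w) s -> cell (j :: w) s -> i = j.
Proof.
have H a b : (a < b)%N -> cell (a :: w) s -> cell (b :: w) s -> False.
  move=> ab; rewrite /cell /= => /andP[_ sa] /andP[sb _].
  pose F n := \sum_(0 <= i < n) P (i :: w).
  have K : F a + P (a :: w) <= F b by have := @P_sum_nd w _ _ ab; rewrite big_nat_recr.
  have {}sa : s < cell_left w + F a + P (a :: w) := sa.
  have {}sb : cell_left w + F b <= s := sb.
  lra.
move=> ci cj; have [ij|ji|//] := ltngtP i j.
  by case: (H _ _ ij ci cj).
by case: (H _ _ ji cj ci).
Qed.

(** Sending the points off [0, 1) to 0 makes the maps built from it total on the reals, and whatever
    holds at all points of [0, 1) then holds for them everywhere. *)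
Definition unit_clip (s : R) : R := if 0 <= s < 1 then s else 0.

Lemma unit_clip_itv s : 0 <= unit_clip s < 1.
Proof. by rewrite /unit_clip; case: ifPn => // _; rewrite lexx ltr01. Qed.

Definition next_child (s : R) (w : seq nat) : nat := xget 0%N [set j | cell (j :: w) s].

Fixpoint tree_word (s : R) (k : nat) : seq nat :=
  if k is k'.+1 then next_child s (tree_word s k') :: tree_word s k' else [::].

Definition tree_path (s : R) (k : nat) : nat :=
  next_child (unit_clip s) (tree_word (unit_clip s) k).

Lemma prefix_tree_path s k : rev_prefix (tree_path s) k = tree_word (unit_clip s) k.
Proof. by elim: k => //= k ->. Qed.

Lemma tree_word_cell s k : 0 <= s < 1 -> cell (tree_word s k) s.
Proof.
move=> s01; elim: k => [|k /cell_child IH]; first by rewrite /cell/= P_nil add0r.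
exact: xgetPex IH.
Qed.

Lemma tree_word_uniq s w : cell w s -> tree_word s (size w) = w.
Proof.
elim: w => // j w IH cjw /=; have cw := cell_sub cjw; rewrite (IH cw); congr (_ :: _).
apply: (@cell_child_uniq w _ _ s) => //.
by have /= := xgetPex 0%N (ex_intro (fun j => cell (j :: w) s) j cjw).
Qed.

(** A half-open cell that contains a point has positive length. Thus every real, without an
    exceptional null set, reads only words of positive mass. *)
Lemma tree_path_gt0 s k : 0 < P (rev_prefix (tree_path s) k).
Proof.
rewrite prefix_tree_path; have /andP[] := tree_word_cell k (unit_clip_itv s).
move=> a b; lra.
Qed.

Lemma cell_subU w : cell w `<=` `[0, 1[.
Proof.
elim: w => [s|j w IH]; last exact: subset_trans (@cell_sub j w) IH.
by rewrite /cell/= P_nil add0r in_itv.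
Qed.

Lemma cell_itv w : cell w = `[cell_left w, cell_left w + P w[%classic.
Proof. by apply/seteqP; split => s; rewrite /cell/= in_itv. Qed.

Lemma tree_path_preimage w :
  `[0, 1[ `&` [set s | rev_prefix (tree_path s) (size w) = w] = cell w.
Proof.
apply/seteqP; split => s.
  rewrite /= in_itv /= prefix_tree_path => -[s01 E].
  have := tree_word_cell (size w) (unit_clip_itv s).
  by rewrite E /unit_clip s01.
move=> cs; have := cell_subU cs; rewrite /= in_itv/= => s01; split => //.
by rewrite prefix_tree_path /unit_clip s01; exact: tree_word_uniq.
Qed.

Lemma measurable_tree_path w :
  measurable [set s | rev_prefix (tree_path s) (size w) = w].
Proof.
set A := [set s | _].
have -> : A = (`[0, 1[ `&` A) `|` (~` `[0, 1[ `&` A).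
  by rewrite -setIUl setUv setTI.
apply: measurableU; first by rewrite tree_path_preimage cell_itv; exact: measurable_itv.
have Aout s : (~` `[0, 1[) s -> A s = A 0.
  rewrite /= in_itv /= => /negP/negbTE s01.
  by rewrite /A /= !prefix_tree_path /unit_clip s01 lexx ltr01.
have [A0|A0] := pselect (A 0).
  rewrite (_ : _ `&` A = ~` `[0, 1[); first by apply: measurableC; exact: measurable_itv.
  by apply/seteqP; split => s; [case|move=> s01; split => //; rewrite Aout].
rewrite (_ : _ `&` A = set0)//; apply/seteqP; split => s // -[s01].
by rewrite Aout.
Qed.

Lemma lebU_tree_path w :
  lebU [set s | rev_prefix (tree_path s) (size w) = w] = (P w)%:E.
Proof.
rewrite lebUE tree_path_preimage cell_itv lebesgue_measure_itv /= lte_fin.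
have [_|] := ltP; first by rewrite -EFinB addrAC subrr add0r.
by rewrite gerDl => P0; congr _%:E; apply/eqP; rewrite eq_le P0 P_ge0.
Qed.

End tree_realization.

(** * Ultralimits of coded probability measures *)

Lemma ultra_cvg_segment (R : realType) (I : Type) (U : set_system I) (p : I -> R) a b :
  UltraFilter U -> (forall i, a <= p i <= b) -> exists l : R, p i @[i --> U] --> l.
Proof.
move=> UU pab.
have : ProperFilter (p i @[i --> U]) by exact: fmap_proper_filter.
move=> /(@segment_compact R a b) H.
have [|l [_ cl]] := H.
  have : U [set i | a <= p i <= b] by apply: filterE; exact: pab.
  by apply: (@filterS _ U) => i /=; rewrite in_itv.
exists l => V nV.
have [//|UV] := in_ultra_setVsetC (p @^-1` V) UU.
have [y [/= nVy Vy]] := cl (~` V) V UV nV.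
by case: nVy.
Qed.

Section word_events.
Context d (T : measurableType d) (b : T -> nat -> nat).
Hypothesis mb : forall k i, measurable [set z | b z k = i].

Definition word_event (w : seq nat) : set T :=
  [set z | rev_prefix (b z) (size w) = w].

Lemma word_event_cons i w :
  word_event (i :: w) = word_event w `&` [set z | b z (size w) = i].
Proof.
by apply/seteqP; split => z; rewrite /word_event /= => -[] -> ->.
Qed.

Lemma measurable_word_event w : measurable (word_event w).
Proof.
elim: w => [|i w IH]; last by rewrite word_event_cons; exact: measurableI.
by rewrite (_ : word_event [::] = setT)//; apply/seteqP; split.
Qed.

(* The event [b k = i], cut along the enumeration of the words of length [k]. *)
Definition letter_event (k i n : nat) : set T :=
  if @pickle_inv (seq nat) n is Some w then
    if size w == k then word_event (i :: w) else set0
  else set0.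

Lemma measurable_letter_event k i n : measurable (letter_event k i n).
Proof.
rewrite /letter_event; case: (@pickle_inv (seq nat) n) => // w; case: ifP => // _.
exact: measurable_word_event.
Qed.

Lemma trivIset_letter_event k i : trivIset setT (letter_event k i).
Proof.
move=> m n _ _ [z []]; rewrite /letter_event.
case Em : (@pickle_inv (seq nat) m) => [v|]//; case: ifP => // /eqP sv.
case En : (@pickle_inv (seq nat) n) => [w|]//; case: ifP => // /eqP sw.
rewrite /word_event /= sv sw => -[_ wv] [_ ww].
have := @pickle_invK (seq nat) m; have := @pickle_invK (seq nat) n; rewrite Em En /= => <- <-.
by congr pickle; rewrite -wv -ww.
Qed.

Lemma bigcup_letter_event k i :
  \bigcup_n letter_event k i n = [set z | b z k = i].
Proof.
apply/seteqP; split => z.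
  move=> [n _]; rewrite /letter_event; case: (@pickle_inv (seq nat) n) => // w.
  by case: ifP => // /eqP <-; rewrite word_event_cons => -[].
move=> /= bz; exists (pickle (rev_prefix (b z) k)) => //.
rewrite /letter_event pickleK_inv size_rev_prefix eqxx word_event_cons.
by split; rewrite /word_event /= size_rev_prefix.
Qed.

End word_events.

Lemma cvg_sum_nat (R : realType) (F : set_system nat) (f : nat -> nat -> R) (g : nat -> R) n :
  Filter F -> (forall i, f i l @[l --> F] --> g i) ->
  \sum_(0 <= i < n) f i l @[l --> F] --> \sum_(0 <= i < n) g i.
Proof.
move=> FF fg; elim: n => [|n IH].
  rewrite big_geq// (_ : (fun l => _) = cst 0); first exact: cvg_cst.
  by apply/funext => l; rewrite big_geq.
rewrite big_nat_recr//= (_ : (fun l => _) = (fun l => \sum_(0 <= i < n) f i l + f n l)).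
  exact: (cvgD IH (fg n)).
by apply/funext => l; rewrite big_nat_recr.
Qed.

Section weak_limit.
Context {R : realType} d (T : measurableType d).
Variables (nu : nat -> {measure set T -> \bar R}) (a : nat -> T -> nat -> nat).
Hypothesis nuT : forall l, nu l setT = 1%E.
Hypothesis ma : forall l k i, measurable [set z | a l z k = i].
Hypothesis tight : forall k (e : R), 0 < e ->
  exists J, forall l, (nu l [set z | (J <= a l z k)%N] <= e%:E)%E.

Let mW l w : measurable (word_event (a l) w).
Proof. exact/measurable_word_event/ma. Qed.

Definition word_mass l w : R := fine (nu l (word_event (a l) w)).

Lemma nu_le1 l A : measurable A -> (nu l A <= 1)%E.
Proof. by move=> mA; rewrite -(nuT l); apply: le_measure; rewrite ?inE. Qed.

Lemma nu_fin l A : measurable A -> nu l A \is a fin_num.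
Proof.
by move=> mA; rewrite ge0_fin_numE// (le_lt_trans (nu_le1 l mA))// ltry.
Qed.

Lemma word_massE l w : (word_mass l w)%:E = nu l (word_event (a l) w).
Proof. by rewrite /word_mass fineK// nu_fin. Qed.

Lemma word_mass_itv l w : 0 <= word_mass l w <= 1.
Proof. by rewrite -!lee_fin word_massE measure_ge0 nu_le1. Qed.

Lemma sum_word_massE l w n : (\sum_(0 <= i < n) word_mass l (i :: w))%:E =
  nu l (word_event (a l) w `&` [set z | (a l z (size w) < n)%N]).
Proof.
elim: n => [|n IH].
  rewrite big_geq// (_ : _ `&` _ = set0) ?measure0//.
  by apply/seteqP; split => z // -[].
rewrite big_nat_recr//= EFinD IH word_massE word_event_cons -measureU.
- congr (nu l _); rewrite -setIUr; congr (_ `&` _).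
  apply/seteqP; split => z /=; first by case=> [/ltnW|->].
  by rewrite ltnS leq_eqVlt => /orP[/eqP|]; [right|left].
- apply: measurableI => //; apply: measurable_code (ma l (size w)) [set i | (i < n)%N].
- exact: measurableI.
- by apply/seteqP; split => z // -[[_ /= +] [_ /= E]]; rewrite E ltnn.
Qed.

Lemma sum_word_mass_tail w e : 0 < e -> exists J, forall l n, (J <= n)%N ->
  word_mass l w - e <= \sum_(0 <= i < n) word_mass l (i :: w) <= word_mass l w.
Proof.
move=> e0; have [J HJ] := tight (size w) e0; exists J => l n Jn.
have mn : measurable [set z | (a l z (size w) < n)%N].
  exact: measurable_code (ma l (size w)) [set i | (i < n)%N].
have mn' : measurable [set z | (n <= a l z (size w))%N].
  exact: measurable_code (ma l (size w)) [set i | (n <= i)%N].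
have mJ' : measurable [set z | (J <= a l z (size w))%N].
  exact: measurable_code (ma l (size w)) [set i | (J <= i)%N].
rewrite lerBlDr -!lee_fin EFinD sum_word_massE word_massE; apply/andP; split.
  apply: (@le_trans _ _ (nu l (word_event (a l) w `&` [set z | (a l z (size w) < n)%N]) +
     nu l [set z | (n <= a l z (size w))%N]))%E.
    rewrite -measureU; last 3 first.
    - exact: measurableI.
    - exact: mn'.
    - by apply/seteqP; split => z // -[[_ /= h] h']; move: (leq_trans h h'); rewrite ltnn.
    apply: le_measure; rewrite ?inE//; first by apply: measurableU => //; exact: measurableI.
    by move=> z wz /=; have [|] := leqP n (a l z (size w)); [right|left].
  apply: leeD2l; apply: le_trans (HJ l); apply: le_measure; rewrite ?inE//.
  by move=> z /= /(leq_trans Jn).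
by apply: le_measure; rewrite ?inE//; exact: measurableI.
Qed.

Variable U : set_system nat.
Hypothesis UU : UltraFilter U.

Let UP : ProperFilter U := ultra_proper.

Definition limit_mass w : R := lim (word_mass l w @[l --> U]).

Lemma limit_massP w : word_mass l w @[l --> U] --> limit_mass w.
Proof.
have [l Hl] := ultra_cvg_segment UU (word_mass_itv^~ w).
by rewrite /limit_mass (cvg_lim _ Hl).
Qed.

Lemma limit_mass_ge0 w : 0 <= limit_mass w.
Proof.
apply: (ler_cvg_to (cvg_cst 0) (@limit_massP w)).
by apply: filterE => l; case/andP: (word_mass_itv l w).
Qed.

Lemma limit_mass_nil : limit_mass [::] = 1.
Proof.
apply/(cvg_lim (@Rhausdorff R)); rewrite (_ : word_mass ^~ _ = cst 1); first exact: cvg_cst.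
apply/funext => l; rewrite /word_mass (_ : word_event _ _ = setT) ?nuT//.
by apply/seteqP; split.
Qed.

Lemma limit_mass_sum_cvg w n : \sum_(0 <= i < n) word_mass l (i :: w) @[l --> U] -->
  \sum_(0 <= i < n) limit_mass (i :: w).
Proof. by apply: cvg_sum_nat => i; exact: limit_massP. Qed.

(** Here tightness is used: the tail of the sum over the children is small uniformly in [l], so the
    bound survives the ultralimit and no mass escapes to letters at infinity. *)
Lemma limit_mass_sum w : \sum_(0 <= i < n) limit_mass (i :: w) @[n --> \oo] --> limit_mass w.
Proof.
apply/cvgrPdist_le => e e0; have [J HJ] := sum_word_mass_tail w e0.
exists J => // n /= Jn; rewrite ger0_norm ?subr_ge0.
  rewrite lerBlDr -lerBlDl.
  apply: (ler_cvg_to (cvgB (@limit_massP w) (cvg_cst e)) (@limit_mass_sum_cvg w n)).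
  by apply: filterE => l; case/andP: (HJ l n Jn).
apply: (ler_cvg_to (@limit_mass_sum_cvg w n) (@limit_massP w)).
by apply: filterE => l; case/andP: (HJ l n Jn).
Qed.

Definition limit_path : R -> nat -> nat := tree_path limit_mass.

Lemma limit_path_word w :
  measurable (word_event (limit_path : measurableTypeR R -> _) w) /\
  lebU (word_event (limit_path : measurableTypeR R -> _) w) = (limit_mass w)%:E.
Proof.
have := lebU_tree_path limit_mass_nil limit_mass_ge0 limit_mass_sum w.
have := measurable_tree_path limit_mass_nil limit_mass_ge0 limit_mass_sum w.
by [].
Qed.

Lemma measurable_limit_path k i : measurable [set s | limit_path s k = i].
Proof.
rewrite -(bigcup_letter_event limit_path); apply: bigcupT_measurable => n.
rewrite /letter_event; case: pickle_inv => // w; case: ifP => // _.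
by have [] := limit_path_word (i :: w).
Qed.

(** A prefix read by [s] has positive limit mass, hence positive mass for [U]-many [l], hence is
    read by an actual point of [T]. This carries pointwise estimates from the approximations to
    every [s]. *)
Lemma limit_path_agree s k : 
  U [set l | exists z, forall j, (j < k)%N -> a l z j = limit_path s j].
Proof.
have := tree_path_gt0 limit_mass_nil limit_mass_sum s k.
rewrite -/limit_path => w0.
have H : U [set l | 0 < word_mass l (rev_prefix (limit_path s) k)].
  exact: cvgr_gt (@limit_massP (rev_prefix (limit_path s) k)) _ w0.
apply: filterS H => l /=; rewrite -lte_fin word_massE => h.
have /set0P[z zw] : word_event (a l) (rev_prefix (limit_path s) k) != set0.
  by apply/eqP => E; move: h; rewrite E measure0 ltxx.
exists z; apply: rev_prefix_inj; move: zw; rewrite /word_event /=.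
by rewrite size_rev_prefix.
Qed.

(** The event is an infinite union of word events, and finite subsums pass to the ultralimit; this
    yields an inequality only. Equality is recovered afterwards by comparing total masses. *)
Lemma limit_path_letter_le k i (c : R) :
  (forall l, (nu l [set z | a l z k = i] <= c%:E)%E) ->
  (lebU [set s | limit_path s k = i] <= c%:E)%E.
Proof.
move=> Hc.
pose F := @letter_event _ (measurableTypeR R) limit_path k i.
have mF n : measurable (F n).
  exact: (measurable_letter_event measurable_limit_path).
have -> : [set s | limit_path s k = i] = \bigcup_n F n.
  exact/esym/(bigcup_letter_event (limit_path : measurableTypeR R -> _)).
rewrite measure_bigcup//; last exact: trivIset_letter_event.
apply: lime_le; first exact: is_cvg_nneseries.
apply: nearW => N.
under eq_bigl do rewrite in_setT.
pose q n (f : seq nat -> R) : R := if @pickle_inv (seq nat) n is Some w then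
    if size w == k then f (i :: w) else 0 else 0.
have qE d' (T' : measurableType d') (m : {measure set T' -> \bar R}) (f : seq nat -> R)
    (b : T' -> nat -> nat) n :
    (forall w, m (word_event b w) = (f w)%:E) ->
    m (letter_event b k i n) = (q n f)%:E.
  move=> H; rewrite /letter_event /q; case: pickle_inv => [w|]; last by rewrite measure0.
  by case: ifP => _; rewrite ?measure0// H.
rewrite (eq_bigr (fun n => (q n limit_mass)%:E)); last first.
  by move=> n _; apply: qE => w; have [] := limit_path_word w.
rewrite sumEFin lee_fin.
have : \sum_(0 <= n < N) q n (word_mass l) @[l --> U] --> \sum_(0 <= n < N) q n limit_mass.
  apply: cvg_sum_nat => n; rewrite /q; case: pickle_inv => [w|]; last exact: cvg_cst.
  by case: ifP => _; [exact: limit_massP|exact: cvg_cst].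
move=> /ler_cvg_to/(_ (cvg_cst c)); apply; apply: filterE => l.
rewrite -lee_fin -sumEFin; apply: le_trans (Hc l).
rewrite -(bigcup_letter_event (a l)) measure_bigcup//; last 2 first.
- by move=> n _; exact/measurable_letter_event/ma.
- exact: trivIset_letter_event.
rewrite (eq_bigr (fun n => nu l (letter_event (a l) k i n))).
  apply: le_trans (nneseries_lim_ge (P := mem [set: nat]) N _) => //.
  rewrite [leRHS](eq_bigl xpredT)// => n; exact: (in_setT n).
by move=> n _; apply/esym/qE => w; rewrite word_massE.
Qed.

(** A first letter is a word of length one, so its mass is itself an ultralimit and lower bounds
    pass to the limit as well. For this reason the good set is recorded in letter 0. *)
Lemma limit_path_head i (c : R) (e : nat -> R) :
  (forall l, ((c - e l)%:E <= nu l [set z | a l z 0%N = i])%E) ->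
  e l @[l --> U] --> (0 : R) ->
  (c%:E <= lebU [set s | limit_path s 0%N = i])%E.
Proof.
move=> Hc e0.
have E d' (T' : measurableType d') (b : T' -> nat -> nat) : [set z | b z 0%N = i] = word_event b [:: i].
  by apply/seteqP; split => z; rewrite /word_event /=; [move=> ->|case].
rewrite (E _ (measurableTypeR R)) (limit_path_word _).2 lee_fin.
have C : c - e l @[l --> U] --> c - 0 by apply: cvgB => //; exact: cvg_cst.
rewrite subr0 in C; apply: (ler_cvg_to C (@limit_massP [:: i])).
by apply: filterE => l; rewrite -lee_fin word_massE -E.
Qed.

End weak_limit.

(** * Attainment of the box distance *)

Lemma prob_add_setC (R : realType) d (T : measurableType d)
    (m : {measure set T -> \bar R}) (A : set T) :
  m setT = 1%E -> measurable A -> (m A + m (~` A) = 1)%E.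
Proof.
move=> mT mA; rewrite -measureU//; last exact: setICr.
  by rewrite setUCr.
exact: measurableC.
Qed.

(** Both laws have total mass 1, so a strict inequality at one letter would leave the dominated law
    short of mass on the other letters. *)
Lemma prob_code_eq (R : realType) d1 d2 (T1 : measurableType d1)
    (T2 : measurableType d2) (m1 : {measure set T1 -> \bar R})
    (m2 : {measure set T2 -> \bar R}) (a1 : T1 -> nat) (a2 : T2 -> nat) :
  m1 setT = 1%E -> m2 setT = 1%E ->
  (forall i, measurable [set z | a1 z = i]) ->
  (forall i, measurable [set z | a2 z = i]) ->
  (forall i, m1 [set z | a1 z = i] <= m2 [set z | a2 z = i])%E ->
  forall i, m1 [set z | a1 z = i] = m2 [set z | a2 z = i].
Proof.
move=> m1T m2T ma1 ma2 a12 i; apply/eqP; rewrite eq_le a12 /=.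
have := measure_code_le ma1 ma2 a12 (~` [set i]).
have := prob_add_setC m1T (ma1 i); have := prob_add_setC m2T (ma2 i).
have -> : ~` [set z | a1 z = i] = [set z | (~` [set i]) (a1 z)] by [].
have -> : ~` [set z | a2 z = i] = [set z | (~` [set i]) (a2 z)] by [].
move: (measure_ge0 m1 [set z | a1 z = i]) (measure_ge0 m1 [set z | (~` [set i]) (a1 z)]).
move: (measure_ge0 m2 [set z | a2 z = i]) (measure_ge0 m2 [set z | (~` [set i]) (a2 z)]).
move: (m1 _) (m1 _) (m2 _) (m2 _) => x y z t.
case: x y z t => [x||] [y||] [z||] [t||]//= _ _ _ _ [zt] [xy].
by rewrite !lee_fin => yt; lra.
Qed.

Section code_limits.
Context {R : realType} (X : mmspace R).

Lemma code_tail k (e : R) : 0 < e ->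
  exists J, (mm_mu X [set x | (J <= mm_code k x)%N] <= e%:E)%E.
Proof.
move=> e0.
have mA J : @measurable _ (mm_sig X) [set x | (J <= mm_code k x)%N].
  exact: (@measurable_code _ (mm_sig X) _ (@mm_borel_code _ X k) [set i | (J <= i)%N]).
have := @nonincreasing_cvg_mu _ _ _ (mmeas (X := X)) (fun J => [set x | (J <= mm_code k x)%N]).
rewrite (_ : \bigcap_n _ = set0); last first.
  apply/seteqP; split => x //= /(_ (mm_code k x).+1 I); by rewrite /= ltnn.
rewrite measure0 => H.
have {H} : mmeas (X := X) [set x | (J <= mm_code k x)%N] @[J --> \oo] --> 0%E.
  apply: H => //.
  - apply: (@le_lt_trans _ _ 1%E); last exact: ltry.
    by rewrite -(mmeas_setT X); apply: le_measure; rewrite ?inE//; exact: mA.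
  - by move=> m n mn; apply/subsetPset => x /=; exact: leq_trans.
move=> /fine_cvgP[_ /cvgrPdist_le/(_ e e0)[J _ /(_ J (leqnn J))]] /= H.
exists J; rewrite -mmeasE; last exact: mA.
rewrite -[leLHS]fineK; last first.
  rewrite ge0_fin_numE//; apply: (@le_lt_trans _ _ 1%E); last exact: ltry.
  by rewrite -(mmeas_setT X); apply: le_measure; rewrite ?inE//; exact: mA.
by rewrite lee_fin; apply: le_trans H; rewrite sub0r normrN; exact: ler_norm.
Qed.

(** Consistency at every finite level makes the chosen dense points a Cauchy sequence; the strict
    inequalities survive in the limit only as weak ones. *)
Lemma code_limit_point (i : nat -> nat) :
  (forall k, exists x : mm_car X, forall j, (j <= k)%N ->
     mm_d X x (dense_pt X (i j)) < mesh j) ->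
  exists x : mm_car X, forall k, mm_d X x (dense_pt X (i k)) <= mesh k.
Proof.
move=> H.
have close k l : (k <= l)%N ->
    mm_d X (dense_pt X (i k)) (dense_pt X (i l)) < mesh k + mesh l.
  move=> kl; have [x xi] := H l; have := mm_d_tri (dense_pt X (i k)) x (dense_pt X (i l)).
  by have := xi k kl; have := xi l (leqnn l); rewrite (mm_d_sym _ x); lra.
have [|x Hx] := @mm_complete R X (fun k => dense_pt X (i k)).
  move=> e e0; have [N Ne] : exists k, mesh k < e / 2 by apply: mesh_small; lra.
  exists N => m n Nm Nn.
  have mm := @mesh_le R _ _ Nm; have mn := @mesh_le R _ _ Nn.
  have [mn'|/ltnW nm'] := leqP m n; first by have := close _ _ mn'; lra.
  by rewrite mm_d_sym; have := close _ _ nm'; lra.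
exists x => k; apply/ler_addgt0Pr => e e0.
have [N HN] := Hx (e / 2) ltac:(lra).
have [M Me] : exists k, mesh k < e / 2 by apply: mesh_small; lra.
pose L := maxn k (maxn N M).
have := close k L (leq_maxl _ _).
have := HN L (leq_trans (leq_maxl N M) (leq_maxr _ _)).
have := @mesh_le R _ _ (leq_trans (leq_maxr N M) (leq_maxr k _)).
have := mm_d_tri x (dense_pt X (i L)) (dense_pt X (i k)).
have := mm_d_sym x (dense_pt X (i L)).
have := mm_d_sym (dense_pt X (i L)) (dense_pt X (i k)).
rewrite -/L; move: L Me => L Me; lra.
Qed.

End code_limits.

Definition has_law (R : realType) (X : mmspace R) d (T : measurableType d)
    (m : {measure set T -> \bar R}) (f : T -> mm_car X) : Prop :=
  forall B, mm_borel X B -> measurable (f @^-1` B) /\ m (f @^-1` B) = mm_mu X B.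

Lemma has_law_parameter (R : realType) (X : mmspace R) (f : R -> mm_car X) :
  has_law (lebU : {measure set (measurableTypeR R) -> \bar R}) f -> mm_parameter X f.
Proof.
move=> H; split => B /H[mB E]; first by apply: measurableI => //; exact: measurable_itv.
by rewrite -E lebUE.
Qed.

Lemma has_law_code_limit (R : realType) (X : mmspace R) d (T : measurableType d)
    (m : {measure set T -> \bar R}) (f : T -> mm_car X) (b : nat -> T -> nat) :
  m setT = 1%E ->
  (forall z k, mm_d X (f z) (dense_pt X (b k z)) <= mesh k) ->
  (forall k i, measurable [set z | b k z = i]) ->
  (forall k i, m [set z | b k z = i] <= mm_mu X [set x | mm_code k x = i])%E ->
  has_law m f.
Proof.
move=> mT fb mb bX B mB.
have H k i : m [set z | b k z = i] = mmeas (X := X) [set x | mm_code k x = i].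
  apply: (prob_code_eq mT (mmeas_setT X) (mb k)) => j; first exact: mm_borel_code.
  by have := bX k j; rewrite -mmeasE //; exact: mm_borel_code.
have [| |H1 H2 H3] := @code_law_eq R X _ _ T (mm_sig X) m (mmeas (X := X)) f id
   b (@mm_code R X) mT (mmeas_setT X) fb _ mb _ H B mB.
- by move=> x k; apply: ltW; exact: mm_codeP.
- exact: mm_borel_code.
- by split => //; rewrite H3; exact: mmeasE.
Qed.

Section box_limit.
Context {R : realType} (X Y : mmspace R) d (T : measurableType d).
Variables (nu : nat -> {measure set T -> \bar R}).
Variables (f : nat -> T -> mm_car X) (g : nat -> T -> mm_car Y) (E : nat -> set T).
Variables (eps : nat -> R) (D : R).
Hypothesis nuT : forall l, nu l setT = 1%E.
Hypothesis fX : forall l, has_law (nu l) (f l).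
Hypothesis gY : forall l, has_law (nu l) (g l).
Hypothesis mE : forall l, measurable (E l).
Hypothesis nuE : forall l, ((1 - eps l)%:E <= nu l (E l))%E.
Hypothesis Edis : forall l z z', E l z -> E l z' ->
  `| mm_d X (f l z) (f l z') - mm_d Y (g l z) (g l z') | <= eps l.
Hypothesis D0 : 0 <= D.
Hypothesis epsD : eps l @[l --> \oo] --> D.

(* Letter 0 records membership in [E l], the odd (resp. even positive) letters the
   codes of the [X]- (resp. [Y]-) component. *)
Definition joint_code (l : nat) (z : T) (n : nat) : nat :=
  match n with
  | 0 => (z \in E l)
  | n'.+1 => if odd n' then mm_code n'./2 (g l z) else mm_code n'./2 (f l z)
  end.

Lemma joint_codeX l z k : joint_code l z (k.*2).+1 = mm_code k (f l z).
Proof. by rewrite /joint_code odd_double doubleK. Qed.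

Lemma joint_codeY l z k : joint_code l z (k.*2).+2 = mm_code k (g l z).
Proof. by rewrite /joint_code /= odd_double /= uphalf_double. Qed.

Lemma measurable_joint_code l k i : measurable [set z | joint_code l z k = i].
Proof.
case: k => [|k] /=.
  apply: (@measurable_code _ _ (fun z => (z \in E l) : nat) _ [set j | j = i]) => j.
  have E1 : [set z | (z \in E l : nat) = 1%N] = E l.
    by apply/seteqP; split => z /=; [have [/set_mem|] := boolP (z \in E l)|move=> /mem_set ->].
  have E0 : [set z | (z \in E l : nat) = 0%N] = ~` E l.
    apply/seteqP; split => z /=; last by move=> nE; rewrite memNset.
    by have [//|/negP h _ /mem_set] := boolP (z \in E l).
  case: j => [|[|j]]; first by rewrite E0; exact: measurableC.
    by rewrite E1.
  rewrite (_ : [set _ | _] = set0)//; apply/seteqP; split => z //=.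
  by case: (_ \in _).
case: (odd k).
  exact: (gY l (mm_borel_code (X := Y) k./2 i)).1.
exact: (fX l (mm_borel_code (X := X) k./2 i)).1.
Qed.

Lemma tight_joint_code k (e : R) : 0 < e ->
  exists J, forall l, (nu l [set z | (J <= joint_code l z k)%N] <= e%:E)%E.
Proof.
move=> e0; case: k => [|k].
  exists 2%N => l; rewrite (_ : [set _ | _] = set0) ?measure0 ?lee_fin ?ltW//.
  by apply/seteqP; split => z //=; case: (_ \in _).
rewrite /=; case: (odd k).
  have [J HJ] := code_tail Y k./2 e0; exists J => l.
  apply: le_trans HJ; rewrite -(gY l _).2//.
  exact: (@measurable_code _ (mm_sig Y) _ (@mm_borel_code _ Y k./2) [set i | (J <= i)%N]).
have [J HJ] := code_tail X k./2 e0; exists J => l.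
apply: le_trans HJ; rewrite -(fX l _).2//.
exact: (@measurable_code _ (mm_sig X) _ (@mm_borel_code _ X k./2) [set i | (J <= i)%N]).
Qed.

(** The source space and the measures on it are arbitrary, so that one statement serves minimising
    sequences of parameters on [0, 1), couplings on a product, and maps defined on a metric measure
    space itself. In each case the limit is realised by parameters on [0, 1). *)
Theorem box_adm_limit : box_adm X Y D.
Proof.
have [U [UU oU]] := ultraFilterLemma (@eventually_filter).
have UP : ProperFilter U by exact: ultra_proper.
pose om := limit_path nu joint_code U.
have mom k i : measurable [set s | om s k = i].
  by have := measurable_limit_path nuT measurable_joint_code tight_joint_code UU k i.
have agree s k : U [set l | exists z, forall j, (j < k)%N -> joint_code l z j = om s j].
  by have := limit_path_agree nuT measurable_joint_code tight_joint_code UU s k.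
have letter k i (c : R) := limit_path_letter_le nuT measurable_joint_code tight_joint_code
   UU (k := k) (i := i) (c := c).
have pX s : exists x : mm_car X, forall k, mm_d X x (dense_pt X (om s (k.*2).+1)) <= mesh k.
  apply: code_limit_point => k.
  have [l [z zs]] := filter_ex (agree s (k.*2).+2); exists (f l z) => j jk.
  rewrite -zs; first by rewrite joint_codeX; exact: mm_codeP.
  by rewrite !ltnS leq_double.
have pY s : exists y : mm_car Y, forall k, mm_d Y y (dense_pt Y (om s (k.*2).+2)) <= mesh k.
  apply: code_limit_point => k.
  have [l [z zs]] := filter_ex (agree s (k.*2).+3); exists (g l z) => j jk.
  rewrite -zs; first by rewrite joint_codeY; exact: mm_codeP.
  by rewrite !ltnS leq_double.
have [phi phiP] := choice pX; have [psi psiP] := choice pY.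
have fin (Z : mmspace R) k i : mm_mu Z [set x | mm_code k x = i] \is a fin_num.
  rewrite -mmeasE; last exact: mm_borel_code.
  rewrite ge0_fin_numE//; apply: (@le_lt_trans _ _ 1%E); last exact: ltry.
  by rewrite -(mmeas_setT Z); apply: le_measure; rewrite ?inE//; exact: mm_borel_code.
have e0 : eps l - D @[l --> U] --> (0 : R).
  rewrite -(subrr D); apply: cvgB; last exact: cvg_cst.
  by move=> V /epsD /oU.
split => //; exists phi, psi, (`[0, 1[ `&` [set s | om s 0%N = 1%N]); split.
- apply: has_law_parameter; apply: (@has_law_code_limit _ _ _ (measurableTypeR R) _ _ (fun k s => om s (k.*2).+1)) => //.
  + exact: lebU_setT.
  + by move=> k i; exact: mom.
  + move=> k i; rewrite -[leRHS]fineK//; apply: letter => l.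
    rewrite fineK// -(fX l (mm_borel_code k i)).2.
    by under eq_set do rewrite joint_codeX.
- apply: has_law_parameter; apply: (@has_law_code_limit _ _ _ (measurableTypeR R) _ _ (fun k s => om s (k.*2).+2)) => //.
  + exact: lebU_setT.
  + by move=> k i; exact: mom.
  + move=> k i; rewrite -[leRHS]fineK//; apply: letter => l.
    rewrite fineK// -(gY l (mm_borel_code k i)).2.
    by under eq_set do rewrite joint_codeY.
- split; last by move=> s [].
  by apply: measurableI; [exact: measurable_itv|exact: mom].
- rewrite -lebUE.
  apply: (limit_path_head nuT measurable_joint_code tight_joint_code UU (e := fun l => eps l - D)).
    move=> l; rewrite opprB addrA subrK; apply: le_trans (nuE l) _.
    apply: le_measure; rewrite ?inE//; first exact: measurable_joint_code.
    by move=> z Ez /=; rewrite mem_set.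
  exact: e0.
- move=> s t [_ /= s1] [_ /= t1]; apply/ler_addgt0Pr => e e_gt0.
  (* Each limit point is within 2 [mesh k], hence e/8, of its approximation; four such errors make
     e/2, and the other half is left for [eps l - D]. *)
  have [k ke] : exists k, mesh k < e / 16 by apply: mesh_small; lra.
  have Ue : U [set l | eps l - D < e / 2].
    by apply: cvgr_lt e0 _ _; lra.
  (* The letters 0 to 2k+2 contain the membership flag and the level [k] codes of both
     components. *)
  have [l [[[z zs] [z' zs']] le]] :=
    filter_ex (filterI (filterI (agree s (k.*2).+3) (agree t (k.*2).+3)) Ue).
  have Es : E l z by apply: set_mem; have := zs 0%N isT; rewrite s1 /=; case: (_ \in _).
  have Et : E l z' by apply: set_mem; have := zs' 0%N isT; rewrite t1 /=; case: (_ \in _).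
  have := Edis Es Et; have := phiP s k; have := phiP t k.
  have := psiP s k; have := psiP t k.
  rewrite -zs; last by rewrite ltnS.
  rewrite -zs'; last by rewrite ltnS.
  rewrite -zs; last by rewrite ltnS leqnSn.
  rewrite -zs'; last by rewrite ltnS leqnSn.
  rewrite !joint_codeX !joint_codeY => Y1 Y2 X1 X2 dis.
  have := mm_codeP k (f l z); have := mm_codeP k (f l z').
  have := mm_codeP k (g l z); have := mm_codeP k (g l z').
  move=> Y3 Y4 X3 X4.
  have tri (Z : mmspace R) (x y c : mm_car Z) : mm_d Z x c <= mesh k -> mm_d Z y c < mesh k ->
      mm_d Z x y <= e / 8.
    by move=> xc yc; have := mm_d_tri x c y; rewrite (mm_d_sym c); lra.
  have := mm_d_tri4 (phi s) (phi t) (f l z) (f l z').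
  have := mm_d_tri4 (psi s) (psi t) (g l z) (g l z').
  have := tri _ _ _ _ X1 X3; have := tri _ _ _ _ X2 X4.
  have := tri _ _ _ _ Y1 Y3; have := tri _ _ _ _ Y2 Y4.
  move: le dis => /=; rewrite !ler_norml.
  move=> le /andP[? ?] ? ? ? ? /andP[? ?] /andP[? ?]; apply/andP; split; lra.
Qed.

End box_limit.

Section parameters.
Context {R : realType}.
Implicit Types X Y : mmspace R.
Local Notation RR := (measurableTypeR R).

Lemma mmeas_id_law X : has_law (mmeas (X := X)) (id : mm_sig X -> mm_car X).
Proof. by move=> B mB; split; [exact: mB|exact: mmeasE]. Qed.

(** A constant sequence of diagonal couplings is passed through the limit theorem instead of using
    one parameter twice, because this is also the source of the existence of parameters. *)
Lemma box_adm_refl X : box_adm X X 0.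
Proof.
apply: (@box_adm_limit R X X _ (mm_sig X) (fun=> mmeas (X := X)) (fun=> id) (fun=> id)
  (fun=> setT) (fun=> 0)) => //.
- by move=> _; exact: mmeas_setT.
- by move=> _; exact: mmeas_id_law.
- by move=> _; exact: mmeas_id_law.
- by move=> _; rewrite subr0 -(mmeas_setT X); exact: lexx.
- by move=> _ z z' _ _; rewrite subrr normr0.
- exact: cvg_cst.
Qed.

Lemma parameter_exists X : exists phi, mm_parameter X phi.
Proof. by have [_ [phi [_ [_ [? _ _ _ _]]]]] := box_adm_refl X; exists phi. Qed.

Lemma box_adm_sym X Y e : box_adm X Y e -> box_adm Y X e.
Proof.
move=> [e0 [phi [psi [I0 [pX pY mI II dis]]]]]; split => //.
exists psi, phi, I0; split => // s t Is It.
by rewrite distrC; exact: dis.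
Qed.

Lemma box_adm1 X Y : box_adm X Y 1.
Proof.
split => //; have [phi pX] := parameter_exists X; have [psi pY] := parameter_exists Y.
exists phi, psi, set0; split => //; first by split => //; exact: sub0set.
by rewrite subrr measure0.
Qed.

Lemma box_sym X Y : box X Y = box Y X.
Proof.
by rewrite /box; congr inf; apply/seteqP; split => e; exact: box_adm_sym.
Qed.

Lemma box_has_inf X Y : has_inf (box_adm X Y).
Proof. by split; [exists 1; exact: box_adm1|exists 0 => e []]. Qed.

Lemma box_ge0 X Y : 0 <= box X Y.
Proof. by apply: lb_le_inf => [|e []//]; exists 1; exact: box_adm1. Qed.

Lemma box_le X Y e : box_adm X Y e -> box X Y <= e.
Proof. by apply: ge_inf; exists 0 => ? []. Qed.

Lemma box_le1 X Y : box X Y <= 1.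
Proof. exact/box_le/box_adm1. Qed.

Lemma measurable_unit_clip (A : set R) :
  measurable (`[0, 1[ `&` A) -> measurable (unit_clip @^-1` A).
Proof.
move=> mA.
have [A0|A0] := pselect (A 0).
  rewrite (_ : _ @^-1` _ = (`[0, 1[ `&` A) `|` ~` `[0, 1[).
    by apply: measurableU => //; apply: measurableC; exact: measurable_itv.
  apply/seteqP; split => s; rewrite /= in_itv /unit_clip /=.
    by case: ifPn => [s01 As|]; [left|right; exact/negP].
  by move=> [[-> //]|/negP/negbTE ->].
rewrite (_ : _ @^-1` _ = (`[0, 1[ `&` A))//.
apply/seteqP; split => s; rewrite /= in_itv /unit_clip /=; first by case: ifPn.
by move=> [-> ].
Qed.

Lemma parameter_has_law X phi : mm_parameter X phi ->
  has_law (lebU : {measure set RR -> \bar R}) (phi \o unit_clip).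
Proof.
move=> [mphi phiE] B mB; split; first exact: (measurable_unit_clip (mphi B mB)).
rewrite lebUE -phiE//; congr (lebesgue_measure _).
apply/seteqP; split => s; rewrite /= in_itv /= => -[s01]; rewrite /unit_clip s01.
  by [].
by [].
Qed.

Lemma box_adm_inf X Y : box_adm X Y (box X Y).
Proof.
have H (n : nat) : exists e, box_adm X Y e /\ e < box X Y + n.+1%:R^-1.
  have n0 : 0 < n.+1%:R^-1 :> R by rewrite invr_gt0.
  have [e ea lt] := inf_adherent n0 (box_has_inf X Y).
  by exists e.
have [e eP] := choice H.
have [phi phiP] := choice (fun n => (eP n).1.2).
have [psi psiP] := choice phiP.
have [I0 I0P] := choice psiP.
apply: (@box_adm_limit R X Y _ RR (fun=> lebU) (fun n => phi n \o unit_clip)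
   (fun n => psi n \o unit_clip) I0 e).
- by move=> _; exact: lebU_setT.
- by move=> n; have [pX _ _ _ _] := I0P n; exact: parameter_has_law.
- by move=> n; have [_ pY _ _ _] := I0P n; exact: parameter_has_law.
- by move=> n; have [_ _ [mI _] _ _] := I0P n.
- by move=> n; have [_ _ [mI II] le _] := I0P n; rewrite lebUE setIidr.
- move=> n s t Is It; have [_ _ [_ II] _ dis] := I0P n.
  have clipE u : I0 n u -> unit_clip u = u.
    by move=> /II; rewrite /= in_itv /unit_clip /= => ->.
  by rewrite /= !clipE//; exact: dis.
- exact: box_ge0.
- apply/cvgrPdist_lt => d d0; near=> n.
  rewrite ler0_norm; last by rewrite subr_le0; apply: box_le; exact: (eP n).1.
  rewrite opprB ltrBlDl; apply: lt_trans (eP n).2 _; rewrite ltrD2l.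
  near: n; exact: near_infty_natSinv_lt (PosNum d0).
Unshelve. all: by end_near. Qed.

End parameters.

(** * Triangle inequality *)

Section gluing.
Context {R : realType}.
Local Notation RR := (measurableTypeR R).
Local Notation lam := (@lebesgue_measure R).
Variables (a b : RR -> nat).
Hypothesis ma : forall i, measurable [set s | a s = i].
Hypothesis mb : forall i, measurable [set s | b s = i].
Hypothesis ab : forall i, lebU [set s | a s = i] = lebU [set s | b s = i].

Let A i : set RR := `[0, 1[ `&` [set s | a s = i].
Let B i : set RR := `[0, 1[ `&` [set s | b s = i].

Let mA i : measurable (A i).
Proof. by apply: measurableI; [exact: measurable_itv|exact: ma]. Qed.

Let mB i : measurable (B i).
Proof. by apply: measurableI; [exact: measurable_itv|exact: mb]. Qed.

Let AB i : lam (A i) = lam (B i).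
Proof. by have := ab i; rewrite !lebUE. Qed.

Let A_fin i : lam (A i) \is a fin_num.
Proof.
rewrite ge0_fin_numE//; apply: (@le_lt_trans _ _ 1%E); last exact: ltry.
rewrite -(@lebU_setT R) lebUE; apply: le_measure; rewrite ?inE//.
  by apply: measurableI => //; exact: measurable_itv.
by move=> s [].
Qed.

Let c i : {nonneg R} := NngNum (fine_ge0 (measure_ge0 lam (A i)) : 0 <= fine (lam (A i))).

Let inv_c i : {nonneg R} := ((c i)%:num^-1)%:nng.

(* The conditionally independent coupling: [s] and [t] are independent given the
   common value [i] of [a s] and [b t]. *)
Definition glued : {measure set (RR * RR)%type -> \bar R} :=
  mseries (fun i => mscale (inv_c i)
    (mrestr (lam \x lam)%E (measurableX (mA i) (mB i)))) 0.

Let gluedE S : glued S =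
  (\sum_(0 <= i <oo) ((c i)%:num^-1)%:E * (lam \x lam) (S `&` (A i `*` B i)))%E.
Proof. by []. Qed.

Let trivA (D : set RR) : trivIset setT (fun i => D `&` A i).
Proof. by move=> i j _ _ [s [[_ [_ /= <-]] [_ [_ /= <-]]]]. Qed.

Let trivB (D : set RR) : trivIset setT (fun i => D `&` B i).
Proof. by move=> i j _ _ [s [[_ [_ /= <-]] [_ [_ /= <-]]]]. Qed.

Let unit_cup (g : RR -> nat) (D : set RR) :
  \bigcup_i (D `&` (`[0, 1[ `&` [set s | g s = i])) = D `&` `[0, 1[.
Proof.
apply/seteqP; split => s; first by move=> [i _ [Ds [Is _]]].
by move=> [Ds Is]; exists (g s).
Qed.

(** Normalisation of one class. For a class of mass 0 the inverse is 0 by convention, and the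
    identity holds because [x] vanishes too. *)
Let cancel i (x : \bar R) : (0 <= x)%E -> (x <= lam (A i))%E ->
  (((c i)%:num^-1)%:E * (x * lam (A i)) = x)%E.
Proof.
move=> x0 xA; have := A_fin i; rewrite /c /=.
have [|] := eqVneq (lam (A i)) 0%E.
  move=> A0; have -> : x = 0%E by apply/eqP; rewrite eq_le x0 -A0 xA.
  by rewrite mul0e mule0.
move: (measure_ge0 lam (A i)) x0 xA.
case: (lam (A i)) => [r| |] //; case: x => [x| |] // _ _ _; rewrite eqe => r0 _.
by rewrite -!EFinM; congr EFin => /=; field.
Qed.

Let prodE (C D : set RR) : measurable C -> measurable D ->
  (lam \x lam)%E (C `*` D) = (lam C * lam D)%E.
Proof. by move=> mC mD; exact: product_measure1E. Qed.

Lemma glued_fst (D : set RR) : measurable D -> glued (D `*` setT) = lebU D.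
Proof.
move=> mD; rewrite gluedE lebUE setIC -(unit_cup a) measure_bigcup; last 2 first.
- by move=> i _; apply: measurableI => //; exact: mA.
- exact: trivA.
rewrite [RHS](eq_eseriesl (Q := xpredT)); last by move=> i; rewrite in_setT.
apply: eq_eseriesr => i _; rewrite -setXI setTI prodE//; last exact: measurableI.
rewrite -AB; apply: cancel; first exact: measure_ge0.
by apply: le_measure; rewrite ?inE//; exact: measurableI.
Qed.

Lemma glued_snd (D : set RR) : measurable D -> glued (setT `*` D) = lebU D.
Proof.
move=> mD; rewrite gluedE lebUE setIC -(unit_cup b) measure_bigcup; last 2 first.
- by move=> i _; apply: measurableI => //; exact: mB.
- exact: trivB.
rewrite [RHS](eq_eseriesl (Q := xpredT)); last by move=> i; rewrite in_setT.
apply: eq_eseriesr => i _; rewrite -setXI setTI prodE//; last exact: measurableI.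
rewrite [X in (_ * X)%E]muleC; apply: cancel; first exact: measure_ge0.
by rewrite AB; apply: le_measure; rewrite ?inE//; exact: measurableI.
Qed.

Lemma measurable_eq_code : measurable [set z : RR * RR | a z.1 = b z.2].
Proof.
have -> : [set z : RR * RR | a z.1 = b z.2] =
    \bigcup_i ([set s | a s = i] `*` [set s | b s = i]).
  by apply/seteqP; split => z /=; [exists (a z.1)|case=> i _ [/= -> ->]].
by apply: bigcupT_measurable => i; exact: measurableX.
Qed.

Lemma glued_diag : glued (~` [set z : RR * RR | a z.1 = b z.2]) = 0%E.
Proof.
rewrite gluedE eseries0// => i _ _.
rewrite (_ : _ `&` _ = set0) ?measure0 ?mule0//.
by apply/seteqP; split => z // [/= zab [[_ /= az] [_ /= bz]]]; apply: zab; rewrite az bz.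
Qed.

End gluing.

Section triangle.
Context {R : realType}.
Local Notation RR := (measurableTypeR R).

(** The two hypotheses provide different parameters [psi] and [psi'] of [Y], which need not agree
    anywhere. Coupling them independently given equal level [k] codes puts [psi s] and [psi' t]
    within 2 [mesh k]; this costs 4 [mesh k] for a pair of points and disappears in the limit. *)
Lemma box_adm_tri (X Y Z : mmspace R) e1 e2 :
  box_adm X Y e1 -> box_adm Y Z e2 -> box_adm X Z (e1 + e2).
Proof.
move=> [e10 [phi [psi [I0 [pX pY [mI II] leI disI]]]]].
move=> [e20 [psi' [chi [J0 [pY' pZ [mJ JJ] leJ disJ]]]]].
pose a k : RR -> nat := fun s => mm_code k (psi (unit_clip s)).
pose b k : RR -> nat := fun s => mm_code k (psi' (unit_clip s)).
have aP k i := parameter_has_law pY (mm_borel_code (X := Y) k i).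
have bP k i := parameter_has_law pY' (mm_borel_code (X := Y) k i).
have ma k i : measurable [set s | a k s = i] by have [] := aP k i.
have mb k i : measurable [set s | b k s = i] by have [] := bP k i.
have ab k i : lebU [set s | a k s = i] = lebU [set s | b k s = i].
  by transitivity (mm_mu Y [set x | mm_code k x = i]); [exact: (aP k i).2|exact/esym/(bP k i).2].
pose nu k := glued (ma k) (mb k).
have nu1 k (D : set RR) : measurable D -> nu k (D `*` setT) = lebU D.
  by move=> mD; exact: (glued_fst (ma k) (mb k) (ab k)).
have nu2 k (D : set RR) : measurable D -> nu k (setT `*` D) = lebU D.
  by move=> mD; exact: (glued_snd (ma k) (mb k) (ab k)).
have nu3 k : nu k (~` [set z : RR * RR | a k z.1 = b k z.2]) = 0%E by exact: glued_diag.
have nuT k : nu k setT = 1%E by rewrite -setXTT nu1// lebU_setT.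
pose E k := (I0 `*` J0) `&` [set z : RR * RR | a k z.1 = b k z.2].
have mab k : measurable [set z : RR * RR | a k z.1 = b k z.2] by exact: measurable_eq_code.
have mIJ : measurable (I0 `*` J0 : set (RR * RR)) by exact: measurableX.
have mIc : measurable (~` I0 : set RR) by exact: measurableC mI.
have mJc : measurable (~` J0 : set RR) by exact: measurableC mJ.
have clipI s : I0 s -> unit_clip s = s.
  by move=> /II; rewrite /= in_itv /unit_clip /= => ->.
have clipJ s : J0 s -> unit_clip s = s.
  by move=> /JJ; rewrite /= in_itv /unit_clip /= => ->.
have finU (D : set RR) : measurable D -> lebU D \is a fin_num.
  move=> mD; rewrite ge0_fin_numE//; apply: (@le_lt_trans _ _ 1%E); last exact: ltry.
  by rewrite -(@lebU_setT R); apply: le_measure; rewrite ?inE.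
have compl (D : set RR) e : measurable D -> ((1 - e)%:E <= lebU D)%E -> (lebU (~` D) <= e%:E)%E.
  move=> mD; have := prob_add_setC (@lebU_setT R) mD.
  have := finU _ mD; have := finU _ (measurableC mD).
  move: (lebU D) (lebU (~` D)) => x y; case: x => [x||] //; case: y => [y||] // _ _ [xy].
  by rewrite !lee_fin => xe; lra.
apply: (@box_adm_limit R X Z _ (RR * RR)%type nu (fun=> phi \o unit_clip \o fst)
  (fun=> chi \o unit_clip \o snd) E (fun k => e1 + e2 + 4 * mesh k)).
- exact: nuT.
- move=> k B mB; have [mp pE] := parameter_has_law pX mB.
  rewrite (_ : _ @^-1` B = ((phi \o unit_clip) @^-1` B) `*` setT).
    by split; [exact: measurableX|rewrite nu1].
  by apply/seteqP; split => z //= [].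
- move=> k B mB; have [mp pE] := parameter_has_law pZ mB.
  rewrite (_ : _ @^-1` B = setT `*` ((chi \o unit_clip) @^-1` B)).
    by split; [exact: measurableX|rewrite nu2].
  by apply/seteqP; split => z //= [].
- by move=> k; exact: (measurableI _ _ mIJ (mab k)).
- move=> k; have mE : measurable (E k) := measurableI _ _ mIJ (mab k).
  (* Bad pairs have a bad first component, a bad second component, or different codes; the last
     event is null, and the marginals bound the other two by [e1] and [e2]. *)
  have nuC : (nu k (~` E k) <= (e1 + e2)%:E)%E.
    apply: (@le_trans _ _ (nu k ((~` I0) `*` setT `|` setT `*` (~` J0) `|`
        ~` [set z : RR * RR | a k z.1 = b k z.2]))).
      apply: le_measure; rewrite ?inE.
      + exact: measurableC.
      + apply: measurableU; last exact: measurableC.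
        by apply: measurableU; exact: measurableX.
      + move=> z /= Ez; have [Iz|Iz] := pselect (I0 z.1); last by left; left.
        have [Jz|Jz] := pselect (J0 z.2); last by left; right.
        by right => abz; apply: Ez.
    have mX1 : measurable ((~` I0) `*` setT : set (RR * RR)).
      exact: measurableX.
    have mX2 : measurable (setT `*` (~` J0) : set (RR * RR)).
      exact: measurableX.
    have subadd S1 S2 : measurable S1 -> measurable S2 ->
        (nu k (S1 `|` S2) <= nu k S1 + nu k S2)%E by move=> *; exact: measureU2.
    apply: le_trans (subadd _ _ (measurableU _ _ mX1 mX2) (measurableC (mab k))) _.
    rewrite nu3 adde0; apply: le_trans (subadd _ _ mX1 mX2) _.
    rewrite nu1 ?nu2//.
    by rewrite EFinD; apply: leeD; apply: compl; rewrite // lebUE setIidr.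
  have := prob_add_setC (nuT k) mE.
  move: nuC (measure_ge0 (nu k) (E k)) (measure_ge0 (nu k) (~` E k)) (mesh_gt0 (R := R) k).
  move: (nu k (E k)) (nu k (~` E k)) => x y; case: x => [x||] //; case: y => [y||] //.
  by rewrite !lee_fin => ye x0 y0 m0 [xy]; lra.
- move=> k [s t] [s' t'] [[/= Is Jt] abs] [[/= Is' Jt'] abs'].
  rewrite (clipI s)// (clipI s')// (clipJ t)// (clipJ t')//.
  have := disI _ _ Is Is'; have := disJ _ _ Jt Jt'.
  have : mm_d Y (psi s) (psi' t) <= 2 * mesh k.
    have := mm_codeP k (psi s); have := mm_codeP k (psi' t).
    move: abs; rewrite /a /b /= (clipI s)// (clipJ t)// => ->.
    have := mm_d_tri (psi s) (dense_pt Y (mm_code k (psi' t))) (psi' t).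
    rewrite (mm_d_sym (dense_pt Y _)); lra.
  have : mm_d Y (psi s') (psi' t') <= 2 * mesh k.
    have := mm_codeP k (psi s'); have := mm_codeP k (psi' t').
    move: abs'; rewrite /a /b /= (clipI s')// (clipJ t')// => ->.
    have := mm_d_tri (psi s') (dense_pt Y (mm_code k (psi' t'))) (psi' t').
    rewrite (mm_d_sym (dense_pt Y _)); lra.
  have := mm_d_tri4 (psi s) (psi s') (psi' t) (psi' t').
  rewrite !ler_norml => /andP[? ?] ? ? /andP[? ?] /andP[? ?]; apply/andP; split; lra.
- exact: addr_ge0.
- rewrite -[X in _ --> X]addr0; apply: cvgD; first exact: cvg_cst.
  rewrite -[X in _ --> X](mulr0 4); apply: cvgM; first exact: cvg_cst.
  by apply: cvg_expr; rewrite ger0_norm// invf_lt1// ltr1n.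
Qed.

Lemma box_tri (X Y Z : mmspace R) : box X Z <= box X Y + box Y Z.
Proof. by apply: box_le; apply: box_adm_tri; exact: box_adm_inf. Qed.

End triangle.

(** * Supports, and isomorphic spaces at box distance zero *)

Section isomorphic.
Context {R : realType} (X Y : mmspace R).

(** By separability the complement of the support is the union of the countably many null balls with
    dense centres and radii [mesh k]. *)
Lemma mm_supp_null (Z : mmspace R) : exists N : set (mm_car Z),
  [/\ mm_borel Z N, mm_mu Z N = 0%E & ~` mm_supp Z = N].
Proof.
pose bl n k : set (mm_sig Z) := [set y | mm_d Z (dense_pt Z n) y < mesh k].
have mbl n k : measurable (bl n k).
  by apply: (@mm_borel_open _ Z); exact: d_open_ball.
pose nb n k : set (mm_sig Z) := if mmeas (bl n k) == 0%E then bl n k else set0.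
have mnb n k : measurable (nb n k) by rewrite /nb; case: ifP.
have nb0 n k : mmeas (nb n k) = 0%E.
  by rewrite /nb; case: ifP => [/eqP//|_]; exact: measure0.
pose N := \bigcup_n \bigcup_k nb n k.
have mN : measurable N.
  by apply: bigcupT_measurable => n; apply: bigcupT_measurable => k; exact: mnb.
have null (F : nat -> set (mm_sig Z)) :
    (forall n, measurable (F n)) -> (forall n, mmeas (F n) = 0%E) ->
    mmeas (X := Z) (\bigcup_n F n) = 0%E.
  move=> mF F0; have mU : measurable (\bigcup_n F n) by exact: bigcupT_measurable.
  apply: measure_negligible => //.
  by apply: negligible_bigcup => n; exists (F n); split; [exact: mF|exact: F0|].
exists N; split.
- exact: mN.
- rewrite -mmeasE//; apply: (null) => n; last by apply: (null) => k; [exact: mnb|exact: nb0].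
  by apply: bigcupT_measurable => k; exact: mnb.
apply/seteqP; split => x.
  move=> /existsNP[r /not_implyP[r0 /negP nx]].
  have [k kr] : exists k, mesh k < r / 2 by apply: mesh_small; lra.
  have [n xn] := dense_ptP x (mesh_gt0 k).
  exists n => //; exists k => //; rewrite /nb ifT; first by rewrite /bl /= mm_d_sym.
  apply/eqP; rewrite mmeasE; last exact: mbl.
  apply/eqP; rewrite eq_le mm_mu_ge0 ?andbT; last exact: mbl.
  have mr : measurable ([set y | mm_d Z x y < r] : set (mm_sig Z)).
    by apply: (@mm_borel_open _ Z); exact: d_open_ball.
  apply: (@le_trans _ _ (mm_mu Z [set y | mm_d Z x y < r])); last by rewrite leNgt; exact: nx.
  rewrite -(mmeasE (mbl n k)) -(mmeasE mr).
  apply: (le_measure (mmeas (X := Z))); rewrite ?inE//.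
  by move=> y; rewrite /bl /= => yn; have := mm_d_tri x (dense_pt Z n) y; lra.
move=> [n _ [k _]]; rewrite /nb; case: ifP => // /eqP b0 xb sx.
have /sx : 0 < mesh k - mm_d Z (dense_pt Z n) x by rewrite subr_gt0.
apply/negP; rewrite -leNgt -b0.
have mr (r : R) : measurable ([set y | mm_d Z x y < r] : set (mm_sig Z)).
  by apply: (@mm_borel_open _ Z); exact: d_open_ball.
rewrite -(mmeasE (mr _)).
apply: (le_measure (mmeas (X := Z))); rewrite ?inE//.
by move=> y; rewrite /bl /= => yn; have := mm_d_tri (dense_pt Z n) x y; lra.
Qed.

Lemma mm_borel_supp (Z : mmspace R) : mm_borel Z (mm_supp Z).
Proof.
have [N [mN _ E]] := mm_supp_null Z.
by rewrite -[mm_supp Z]setCK E; exact: (@measurableC _ (mm_sig Z)).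
Qed.

Lemma mm_mu_setC_supp (Z : mmspace R) : mm_mu Z (~` mm_supp Z) = 0%E.
Proof. by have [N [_ N0 ->]] := mm_supp_null Z. Qed.

Lemma mm_mu_supp (Z : mmspace R) : mm_mu Z (mm_supp Z) = 1%E.
Proof.
have mS := @mm_borel_supp Z.
have := prob_add_setC (mmeas_setT Z) (mS : measurable (_ : set (mm_sig Z))).
have mC : mm_borel Z (~` mm_supp Z) by exact: (@measurableC _ (mm_sig Z)).
rewrite -[mm_mu Z _]mmeasE//.
by rewrite [X in (_ + X)%E](_ : _ = 0%E) ?adde0// -(mm_mu_setC_supp Z); exact: mmeasE.
Qed.

(** Off the support [f] is arbitrary. On it, the preimage of an open set is the trace of the open
    set [O], a union of balls centred at points of the support. *)
Lemma mm_borel_iso (f : mm_car X -> mm_car Y) :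
  (forall x y, mm_supp X x -> mm_supp X y -> mm_d Y (f x) (f y) = mm_d X x y) ->
  forall B, mm_borel Y B -> mm_borel X (mm_supp X `&` f @^-1` B).
Proof.
move=> isof; have mS : measurable (mm_supp X : set (mm_sig X)) by exact: mm_borel_supp.
apply: mm_borel_ind.
- by rewrite preimage_setT setIT; exact: mS.
- move=> B oB.
  pose O := [set z | exists x r, [/\ mm_supp X x, mm_d X x z < r &
     forall y, mm_d Y (f x) y < r -> B y]].
  have -> : mm_supp X `&` f @^-1` B = mm_supp X `&` O.
    apply/seteqP; split => z [sz].
      move=> /= /oB[r r0 rB]; split => //; exists z, r; split => //.
      by rewrite mm_dxx.
    by move=> [x [r [sx xz rB]]]; split => //; apply: rB; rewrite isof.
  apply: (@measurableI _ (mm_sig X)) => //; apply: (@mm_borel_open _ X).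
  move=> z [x [r [sx xz rB]]]; exists (r - mm_d X x z); first by rewrite subr_gt0.
  move=> y zy; exists x, r; split => //.
  by have := mm_d_tri x z y; lra.
- move=> B _ mB; rewrite (_ : _ `&` _ = mm_supp X `\` (mm_supp X `&` f @^-1` B)).
    exact: (@measurableD _ (mm_sig X)).
  apply/seteqP; split => z [sz Bz]; split => //; first by case.
  by move=> /= Bfz; apply: Bz.
- move=> F _ _ mF; rewrite preimage_bigcup setI_bigcupr.
  exact: (@bigcupT_measurable _ (mm_sig X)).
Qed.

Lemma mm_iso_box_adm0 : mm_iso X Y -> box_adm X Y 0.
Proof.
move=> [f [fs isof muf]]; have [y0 _] := mm_inhabited Y.
have mS : measurable (mm_supp X : set (mm_sig X)) by exact: mm_borel_supp.
(* Off the support [f] need not be measurable, so it is replaced there by a constant; the change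
   concerns a null set. *)
pose g : mm_sig X -> mm_car Y := fun x => if pselect (mm_supp X x) then f x else y0.
have gE x : mm_supp X x -> g x = f x by rewrite /g; case: pselect.
have gN x : ~ mm_supp X x -> g x = y0 by rewrite /g; case: pselect.
apply: (@box_adm_limit R X Y _ (mm_sig X) (fun=> mmeas (X := X)) (fun=> id) (fun=> g)
  (fun=> mm_supp X) (fun=> 0)) => //.
- by move=> _; exact: mmeas_setT.
- by move=> _; exact: mmeas_id_law.
- move=> _ B mB.
  pose S0 : set (mm_sig X) := mm_supp X `&` f @^-1` B.
  have mS0 : measurable S0 by exact: mm_borel_iso.
  pose S1 : set (mm_sig X) := ~` mm_supp X `&` [set _ | B y0].
  have mS1 : measurable S1.
    rewrite /S1; have [By|By] := pselect (B y0).
      by rewrite (_ : [set _ : mm_sig X | B y0] = setT) ?setIT; [exact: measurableC|apply/seteqP; split].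
    by rewrite (_ : [set _ : mm_sig X | B y0] = set0) ?setI0//; apply/seteqP; split.
  have -> : g @^-1` B = S0 `|` S1.
    apply/seteqP; split => x; rewrite /S0 /S1 /=.
      by have [sx|sx] := pselect (mm_supp X x); [rewrite gE//; left|rewrite gN//; right].
    by move=> [[sx]|[sx]]; [rewrite gE|rewrite gN].
  split; first exact: measurableU.
  have E1 : mmeas S1 = 0%E.
    apply/eqP; rewrite eq_le measure_ge0 andbT -(mm_mu_setC_supp X) -mmeasE; last first.
      exact: (measurableC mS).
    apply: (le_measure (mmeas (X := X))); rewrite ?inE//; first exact: (measurableC mS).
    by move=> x [].
  transitivity (mmeas S0 + mmeas S1)%E.
    by apply: measureU => //; apply/seteqP; split => x // [[sx _] []].
  by rewrite E1 adde0 -muf//; exact: mmeasE.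
- move=> _; rewrite subr0.
  have -> : 1%:E = mmeas (mm_supp X) by rewrite (mmeasE mS) mm_mu_supp.
  exact: lexx.
- by move=> _ x y sx sy; rewrite !gE// isof// subrr normr0.
- exact: cvg_cst.
Qed.

Lemma mm_iso_box0 : mm_iso X Y -> box X Y = 0.
Proof.
by move=> /mm_iso_box_adm0/box_le H; apply/eqP; rewrite eq_le H box_ge0.
Qed.

End isomorphic.

(** * Vanishing box distance *)

Lemma le_measure_full (R : realType) d (T : measurableType d)
    (m : {measure set T -> \bar R}) (A B G : set T) :
  measurable A -> measurable B -> measurable G -> m (~` G) = 0%E ->
  A `&` G `<=` B -> (m A <= m B)%E.
Proof.
move=> mA mB mG G0 AGB; have mGc := measurableC mG.
apply: (@le_trans _ _ (m (B `|` ~` G))).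
  apply: le_measure; rewrite ?inE//; first exact: measurableU.
  by move=> z Az; have [Gz|Gz] := pselect (G z); [left; apply: AGB|right].
have : (m (B `|` ~` G) <= m B + m (~` G))%E by exact: measureU2.
by rewrite G0 adde0.
Qed.

Section box_zero.
Context {R : realType} (X Y : mmspace R).
Local Notation RR := (measurableTypeR R).

(** With [eps = 0] the good set has full measure and [phi s |-> psi s] preserves distances on it. As
    the points [phi s] with [s] good approximate every point of the support, completeness of [Y]
    extends this map to the support. *)
Lemma box_adm0_mm_iso : box_adm X Y 0 -> mm_iso X Y.
Proof.
move=> [_ [phi [psi [I0 [pX pY [mI II] leI dis]]]]].
have disE s t : I0 s -> I0 t -> mm_d X (phi s) (phi t) = mm_d Y (psi s) (psi t).
  by move=> Is It; apply/eqP; rewrite -subr_eq0 -normr_le0; exact: dis.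
have mI' : measurable (I0 : set RR) by exact: mI.
have I0full : lebU (~` I0) = 0%E.
  have := prob_add_setC (@lebU_setT R) mI'.
  have : (1 <= lebU I0)%E by move: leI; rewrite subr0 lebUE setIidr.
  have : (0 <= lebU (~` I0))%E by exact: measure_ge0.
  move: (lebU I0) (lebU (~` I0)) => x y; case: x => [x||] //; case: y => [y||] //.
  by rewrite !lee_fin => y0 x1 [xy]; congr EFin; lra.
have lawX := parameter_has_law pX; have lawY := parameter_has_law pY.
have clipI s : I0 s -> unit_clip s = s.
  by move=> /II; rewrite /= in_itv /unit_clip /= => ->.
(* A ball around a support point has positive mass, so its preimage cannot be contained in the null
   complement of [I0]. *)
have hit x r : mm_supp X x -> 0 < r -> exists2 s, I0 s & mm_d X (phi s) x < r.
  move=> sx r0; apply: contrapT => nex; have := sx r r0.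
  have [mA <-] := lawX _ (mm_borel_open (@d_open_ball _ X x r)).
  apply/negP; rewrite -leNgt -I0full.
  apply: le_measure; rewrite ?inE//; first exact: (measurableC mI').
  move=> s /= xs Is; apply: nex; exists s => //.
  by rewrite mm_d_sym -[s in phi s]clipI.
have fex x : exists y, mm_supp X x -> forall e, 0 < e ->
    exists s, [/\ I0 s, mm_d X (phi s) x < e & mm_d Y (psi s) y < e].
  have [sx|nsx] := pselect (mm_supp X x); last first.
    by have [y _] := mm_inhabited Y; exists y.
  have [u uP] := choice (fun n => (fun '(ex_intro2 s Is xs) => ex_intro _ s (conj Is xs))
    (hit x _ sx (@mesh_gt0 R n)) : exists s, I0 s /\ mm_d X (phi s) x < mesh n).
  have [|y yP] := @mm_complete R Y (psi \o u).
    move=> e e0; have [N Ne] : exists k, mesh k < e / 2 by apply: mesh_small; lra.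
    exists N => m n Nm Nn /=; have [Im xm] := uP m; have [In xn] := uP n.
    rewrite -disE//; have := @mesh_le R _ _ Nm; have := @mesh_le R _ _ Nn.
    have := mm_d_tri (phi (u m)) x (phi (u n)); rewrite (mm_d_sym x); lra.
  exists y => _ e e0; have [N HN] := yP e e0.
  have [M Me] := mesh_small e0.
  exists (u (maxn N M)); have [IL xL] := uP (maxn N M); split => //.
    by apply: lt_trans xL _; apply: le_lt_trans Me; apply: mesh_le; exact: leq_maxr.
  by apply: HN; exact: leq_maxl.
have [f fP] := choice fex.
have isof x y : mm_supp X x -> mm_supp X y -> mm_d Y (f x) (f y) = mm_d X x y.
  move=> sx sy; apply/eqP; rewrite -subr_eq0 -normr_le0; apply/ler_addgt0Pr => e e0.
  have e4 : 0 < e / 4 by lra.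
  have [s [Is xs fs]] := fP x sx _ e4; have [t [It yt ft]] := fP y sy _ e4.
  have := mm_d_tri4 (psi s) (psi t) (f x) (f y).
  have := mm_d_tri4 (phi s) (phi t) x y.
  rewrite disE// !ler_norml => /andP[? ?] /andP[? ?]; apply/andP; split; lra.
(* The extension agrees with [psi] at good parameters, so the image measure of [f] can be computed
   on [0, 1). *)
have fpsi s : I0 s -> mm_supp X (phi s) -> f (phi s) = psi s.
  move=> Is ss; apply/(mm_d_eq0 (m := Y)); apply/eqP; rewrite eq_le mm_d_ge0 andbT.
  apply/ler_addgt0Pr => e e0; have e2 : 0 < e / 2 by lra.
  have [t [It xt ft]] := fP _ ss _ e2.
  have := mm_d_tri (f (phi s)) (psi t) (psi s).
  by rewrite -(disE t s)// (mm_d_sym (f _) (psi t)); lra.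
exists f; split => //.
- move=> x sx r r0.
  have r4 : 0 < r / 4 by lra.
  have [s [Is xs fs]] := fP x sx _ r4.
  apply: lt_le_trans (sx _ r4) _.
  have [mA <-] := lawX _ (mm_borel_open (@d_open_ball _ X x (r / 4))).
  have [mB <-] := lawY _ (mm_borel_open (@d_open_ball _ Y (f x) r)).
  apply: (le_measure_full mA mB mI' I0full) => t [/= xt It].
  rewrite clipI// in xt; rewrite clipI//.
  have := mm_d_tri (f x) (psi s) (psi t); rewrite -disE// (mm_d_sym (f x) (psi s)).
  have := mm_d_tri (phi s) x (phi t); lra.
- move=> B mB.
  have mfB : mm_borel X (mm_supp X `&` f @^-1` B) by exact: mm_borel_iso.
  have [mA <-] := lawX _ mfB; have [mC <-] := lawY _ mB.
  have [mS S1] := lawX _ (@mm_borel_supp _ X).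
  have mG := measurableI _ _ mI' mS.
  have G0 : lebU (~` (I0 `&` (phi \o unit_clip) @^-1` mm_supp X)) = 0%E.
    rewrite setCI; apply/eqP; rewrite eq_le measure_ge0 andbT.
    have : (lebU (~` I0 `|` ~` ((phi \o unit_clip) @^-1` mm_supp X)) <=
        lebU (~` I0) + lebU (~` ((phi \o unit_clip) @^-1` mm_supp X)))%E.
      by apply: measureU2; exact: measurableC.
    rewrite I0full add0e; congr (_ <= _)%E.
    have mCS : mm_borel X (~` mm_supp X).
      exact: (@measurableC _ (mm_sig X) _ (@mm_borel_supp _ X)).
    by have [_] := lawX _ mCS; rewrite mm_mu_setC_supp.
  apply/eqP; rewrite eq_le; apply/andP; split.
    apply: (le_measure_full mA mC mG G0) => s [/= [ss Bs] [Is _]].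
    by move: ss Bs; rewrite clipI// => ss; rewrite fpsi.
  apply: (le_measure_full mC mA mG G0) => s [/= Bs [Is /= ss]].
  by split => //; move: ss Bs; rewrite clipI// => ss; rewrite fpsi.
Qed.

Lemma box0_mm_iso : box X Y = 0 -> mm_iso X Y.
Proof. by move=> b0; apply: box_adm0_mm_iso; rewrite -b0; exact: box_adm_inf. Qed.

Lemma box_gt0 : ~ mm_iso X Y -> 0 < box X Y.
Proof.
move=> nXY; rewrite lt_neqAle box_ge0 andbT eq_sym; apply/eqP => b0.
exact/nXY/box0_mm_iso.
Qed.

End box_zero.

(** * Spaces from pseudometrics on the unit interval *)

Section pseudometric_mmspace.
Context {R : realType} (rho : R -> R -> R) (p : nat -> R).
Hypothesis rho_sym : forall x y, rho x y = rho y x.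
Hypothesis rho_tri : forall x y z, rho x z <= rho x y + rho y z.
Hypothesis p_dense : forall x e, 0 < e -> exists n, rho x (p n) < e.
Hypothesis rho_meas : forall x r, measurable (`[0, 1[ `&` [set y | rho x y < r]).

Definition kur_prop (u : nat -> R) : Prop :=
  forall e, 0 < e -> exists i, forall n, `|u n - rho (p i) (p n)| <= e.

(* The completion of [(R, rho)], as the closure of its Kuratowski embedding into
   the sequences with the sup distance. *)
Definition kur : Type := {u : nat -> R | kur_prop u}.

Definition kur_d (u v : kur) : R := sup (range (fun n => `|sval u n - sval v n|)).

Lemma rho_diff x y z : `|rho x z - rho y z| <= rho x y.
Proof.
rewrite ler_norml; have := rho_tri x y z; have := rho_tri y x z.
by rewrite (rho_sym y x) => *; apply/andP; split; lra.
Qed.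

Lemma kur_bounded (u v : kur) : exists c, forall n, `|sval u n - sval v n| <= c.
Proof.
have [i Hi] := svalP u 1 ltr01; have [j Hj] := svalP v 1 ltr01.
exists (2 + rho (p i) (p j)) => n.
have := Hi n; have := Hj n; have := rho_diff (p i) (p j) (p n).
by rewrite !ler_norml => /andP[? ?] /andP[? ?] /andP[? ?]; apply/andP; split; lra.
Qed.

Lemma kur_d_le (u v : kur) c : (forall n, `|sval u n - sval v n| <= c) -> kur_d u v <= c.
Proof.
move=> H; apply: ge_sup; first by exists `|sval u 0%N - sval v 0%N|; exists 0%N.
by move=> _ [n _ <-].
Qed.

Lemma kur_d_ge (u v : kur) n : `|sval u n - sval v n| <= kur_d u v.
Proof.
apply: ub_le_sup; last by exists n.
by have [c cP] := kur_bounded u v; exists c => _ [m _ <-].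
Qed.

Lemma kur_pt_prop x : kur_prop (fun n => rho x (p n)).
Proof.
move=> e e0; have [i xi] := p_dense x e0; exists i => n.
exact: le_trans (rho_diff _ _ _) (ltW xi).
Qed.

Definition kur_pt x : kur := exist _ _ (kur_pt_prop x).

Lemma kur_d_pt x y : kur_d (kur_pt x) (kur_pt y) = rho x y.
Proof.
apply/eqP; rewrite eq_le; apply/andP; split.
  by apply: kur_d_le => n; exact: rho_diff.
apply/ler_addgt0Pr => e e0; have e2 : 0 < e / 2 by lra.
have [n yn] := p_dense y e2; have := kur_d_ge (kur_pt x) (kur_pt y) n.
have := rho_tri x (p n) y; rewrite (rho_sym (p n)) /= ler_norml => ? /andP[? ?]; lra.
Qed.

Lemma kur_d_eq0 u v : kur_d u v = 0 <-> u = v.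
Proof.
split => [uv|->]; last first.
  apply/eqP; rewrite eq_le; apply/andP; split.
    by apply: kur_d_le => n; rewrite subrr normr0.
  exact: le_trans (kur_d_ge v v 0%N).
case: u v uv => [u up] [v vp] uv; apply: eq_exist; apply/funext => n.
by apply/eqP; rewrite -subr_eq0 -normr_le0 -uv; exact: (kur_d_ge (exist _ u up) (exist _ v vp)).
Qed.

Lemma kur_d_sym u v : kur_d u v = kur_d v u.
Proof. by rewrite /kur_d; under eq_fun do rewrite distrC. Qed.

Lemma kur_d_tri u v w : kur_d u w <= kur_d u v + kur_d v w.
Proof.
apply: kur_d_le => n; have := kur_d_ge u v n; have := kur_d_ge v w n.
by rewrite !ler_norml => /andP[? ?] /andP[? ?]; apply/andP; split; lra.
Qed.

Lemma kur_complete (u : nat -> kur) :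
  (forall e : R, 0 < e -> exists N, forall m n, (N <= m)%N -> (N <= n)%N ->
      kur_d (u m) (u n) < e) ->
  exists x, forall e : R, 0 < e -> exists N, forall n, (N <= n)%N -> kur_d (u n) x < e.
Proof.
move=> uC.
(* [S n] collects the eventual lower bounds of the coordinate [n], so [v n] is a lower limit; it
   needs no convergence beforehand. *)
pose S n := [set x | exists N, forall m, (N <= m)%N -> x <= sval (u m) n].
pose v n := sup (S n).
have vP n M e : (forall m, (M <= m)%N -> kur_d (u m) (u M) < e) -> `|sval (u M) n - v n| <= e.
  move=> H.
  have lo m : (M <= m)%N -> sval (u M) n - e <= sval (u m) n <= sval (u M) n + e.
    move=> /H uM; have := kur_d_ge (u m) (u M) n.
    by rewrite ler_norml => /andP[? ?]; apply/andP; split; lra.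
  have S1 : S n (sval (u M) n - e) by exists M => m /lo/andP[].
  have S2 : ubound (S n) (sval (u M) n + e).
    move=> x [N xN]; have /andP[_] := lo _ (leq_maxr N M).
    by apply: le_trans; apply: xN; exact: leq_maxl.
  have : v n <= sval (u M) n + e by apply: ge_sup => //; exists (sval (u M) n - e).
  have : sval (u M) n - e <= v n by apply: ub_le_sup => //; exists (sval (u M) n + e).
  by move=> ? ?; rewrite ler_norml; apply/andP; split; lra.
have near_v e : 0 < e -> exists N, forall M, (N <= M)%N -> forall n, `|sval (u M) n - v n| <= e.
  move=> /uC[N HN]; exists N => M NM n; apply: vP => m Mm.
  by apply: HN => //; exact: leq_trans Mm.
have vK : kur_prop v.
  move=> e e0; have e2 : 0 < e / 2 by lra.
  have [N HN] := near_v _ e2; have [i Hi] := svalP (u N) _ e2.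
  exists i => n; have := HN N (leqnn N) n; have := Hi n.
  by rewrite !ler_norml => /andP[? ?] /andP[? ?]; apply/andP; split; lra.
exists (exist _ v vK) => e e0; have e2 : 0 < e / 2 by lra.
have [N HN] := near_v _ e2; exists N => n Nn.
by apply: (@le_lt_trans _ _ (e / 2)); [apply: kur_d_le => k; exact: HN|lra].
Qed.

Lemma kur_pt_dense x e : 0 < e -> exists n, kur_d x (kur_pt (p n)) < e.
Proof.
move=> e0; have e2 : 0 < e / 2 by lra.
have [i Hi] := svalP x _ e2; exists i.
by apply: (@le_lt_trans _ _ (e / 2)); [exact: kur_d_le|lra].
Qed.

Definition kur_mu (A : set kur) : \bar R := lebesgue_measure (`[0, 1[ `&` kur_pt @^-1` A).

Lemma measurable_kur_pt B : d_borel kur_d B -> measurable (`[0, 1[ `&` kur_pt @^-1` B).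
Proof.
pose C := [set B | measurable (`[0, 1[ `&` kur_pt @^-1` B)].
suff : d_borel kur_d `<=` C by exact.
apply: smallest_sub; last first.
  move=> A oA; rewrite /C /=.
  pose F n k : set R := if `[< forall x, kur_d (kur_pt (p n)) x < mesh k -> A x >]
    then `[0, 1[ `&` [set s | rho (p n) s < mesh k] else set0.
  have -> : `[0, 1[ `&` kur_pt @^-1` A = \bigcup_n \bigcup_k F n k.
    apply/seteqP; split => s.
      move=> [s01 /oA[r r0 rA]].
      have [k kr] : exists k, mesh k < r / 2 by apply: mesh_small; lra.
      have [n sn] := p_dense s (@mesh_gt0 R k).
      exists n => //; exists k => //; rewrite /F; case: asboolP => [_|[]].
        by split => //=; rewrite rho_sym.
      move=> x nx; apply: rA; have := kur_d_tri (kur_pt s) (kur_pt (p n)) x.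
      by rewrite kur_d_pt; lra.
    move=> [n _ [k _]]; rewrite /F; case: asboolP => // H [s01 /= sn]; split => //.
    by apply: H; rewrite kur_d_pt.
  apply: bigcupT_measurable => n; apply: bigcupT_measurable => k.
  by rewrite /F; case: asboolP => _ //; exact: rho_meas.
split.
- by rewrite /C /= preimage_set0 setI0.
- move=> A; rewrite /C /= => mA; rewrite setTD.
  rewrite (_ : _ `&` _ = `[0, 1[ `\` (`[0, 1[ `&` kur_pt @^-1` A)).
    by apply: measurableD => //; exact: measurable_itv.
  by apply/seteqP; split => s [s01 As]; split => //; [case|move=> /= ?; apply: As].
- move=> F; rewrite /C /= => mF; rewrite preimage_bigcup setI_bigcupr.
  exact: bigcupT_measurable.
Qed.

Lemma kur_mu_sigma_additive (F : nat -> set kur) :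
  (forall n, d_borel kur_d (F n)) -> trivIset setT F ->
  (fun n => \sum_(0 <= i < n) kur_mu (F i))%E @ \oo --> kur_mu (\bigcup_n F n).
Proof.
move=> mF tF; rewrite /kur_mu preimage_bigcup setI_bigcupr.
apply: (@measure_semi_sigma_additive _ _ _ (@lebesgue_measure R) (fun n => `[0, 1[ `&` kur_pt @^-1` F n)).
- by move=> n; exact: measurable_kur_pt.
- move=> i j Ti Tj [s [[_ /= si] [_ /= sj]]].
  by apply: (tF i j Ti Tj); exists (kur_pt s).
- by apply: bigcupT_measurable => n; exact: measurable_kur_pt.
Qed.

Lemma kur_mu0 : kur_mu set0 = 0%E.
Proof. by rewrite /kur_mu preimage_set0 setI0 measure0. Qed.

Lemma kur_muT : kur_mu setT = 1%E.
Proof. by rewrite /kur_mu preimage_setT -lebUE lebU_setT. Qed.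

Definition kur_mmspace : mmspace R :=
  @MMSpace R kur kur_d kur_d_eq0 kur_d_sym kur_d_tri kur_complete
    (ex_intro _ (kur_pt \o p) kur_pt_dense) kur_mu kur_mu0
    (fun A _ => measure_ge0 lebesgue_measure _) kur_mu_sigma_additive kur_muT.

(** Reduces the construction of a space to that of a separable pseudometric on the parameter
    interval with measurable balls; the parameter comes for free and is shared by all spaces built
    this way. *)
Lemma pseudometric_mmspace : exists (X : mmspace R) (phi : R -> mm_car X),
  mm_parameter X phi /\ forall s t, mm_d X (phi s) (phi t) = rho s t.
Proof.
exists kur_mmspace, kur_pt; split; last exact: kur_d_pt.
by split => // B mB; exact: measurable_kur_pt.
Qed.

End pseudometric_mmspace.

(** * The interpolating metrics *)

(* Points carry a tag: [None] for the part that is interpolated linearly, [Some false]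
   (resp. [Some true]) for a point that still sits in [X_0] (resp. already in [X_1]). *)
Section glued_metric.
Context {R : realType} (rho : bool -> R -> R -> R) (S : set R) (D : R).
Hypothesis rho_xx : forall c x, rho c x x = 0.
Hypothesis rho_sym : forall c x y, rho c x y = rho c y x.
Hypothesis rho_tri : forall c x y z, rho c x z <= rho c x y + rho c y z.
Hypothesis S_ex : exists s, S s.
Hypothesis D_ge0 : 0 <= D.
Hypothesis rho_dis : forall s s', S s -> S s' -> `|rho false s s' - rho true s s'| <= D.

Definition interp (t x y : R) : R := (1 - t) * rho false x y + t * rho true x y.

Definition tag_d (t : R) (o : option bool) : R -> R -> R :=
  if o is Some c then rho c else interp t.

(** On [S] the metric of side [false] is t D close to the interpolated one, that of side [true]
    (1-t) D close; each gap is [th] times this defect. It vanishes at the end of the path where the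
    side is the whole space, and the two gaps add up to th D. *)
Definition tag_gap (th t : R) (o : option bool) : R :=
  match o with
  | None => 0
  | Some false => th * t * D
  | Some true => th * (1 - t) * D
  end.

Definition bridge_set (t : R) (k k' : option bool * R) : set R :=
  [set l | exists s s', [/\ S s, S s' &
    l = tag_d t k.1 k.2 s + interp t s s' + tag_d t k'.1 s' k'.2]].

Definition bridge (t : R) (k k' : option bool * R) : R := inf (bridge_set t k k').

Definition glued_d (th t : R) (k k' : option bool * R) : R :=
  if k.1 == k'.1 then tag_d t k.1 k.2 k'.2
  else tag_gap th t k.1 + tag_gap th t k'.1 + bridge t k k'.

Section fixed_time.
Variable t : R.
Hypothesis t01 : 0 <= t <= 1.

Lemma tag_d_xx o x : tag_d t o x x = 0.
Proof. by case: o => [c|] /=; rewrite /interp ?rho_xx//; lra. Qed.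

Lemma tag_d_sym o x y : tag_d t o x y = tag_d t o y x.
Proof.
by case: o => [c|] /=; rewrite /interp ?[rho _ y x]rho_sym// (rho_sym false) (rho_sym true).
Qed.

Lemma tag_d_tri o x y z : tag_d t o x z <= tag_d t o x y + tag_d t o y z.
Proof.
case: o => [c|] /=; first exact: rho_tri.
move: t01 => /andP[t0 t1]; rewrite /interp.
have := rho_tri false x y z; have := rho_tri true x y z.
have u0 : 0 <= 1 - t by lra.
move=> /(ler_wpM2l t0) + /(ler_wpM2l u0).
by rewrite !mulrDr; lra.
Qed.

Lemma tag_d_ge0 o x y : 0 <= tag_d t o x y.
Proof. by have := tag_d_tri o x y x; rewrite tag_d_xx (tag_d_sym o y x); lra. Qed.

Lemma tag_d_lt o x y r : rho false x y < r -> rho true x y < r -> tag_d t o x y < r.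
Proof.
case: o => [[]|] //= H0 H1; rewrite /interp; move: t01 => /andP[t0 t1].
have u0 : 0 <= 1 - t by lra.
have A := ler_wpM2l t0 (ltW H1); have B := ler_wpM2l u0 (ltW H0).
have [->|t'] := eqVneq t 0; first by rewrite subr0 mul1r mul0r addr0.
have tp : 0 < t by rewrite lt_neqAle eq_sym t'.
have {}A : t * rho true x y < t * r by rewrite ltr_pM2l.
lra.
Qed.

Lemma bridge_has_inf k k' : has_inf (bridge_set t k k').
Proof.
split; last first.
  exists 0 => _ [s [s' [_ _ ->]]]; have := tag_d_ge0 None s s'.
  by have := tag_d_ge0 k.1 k.2 s; have := tag_d_ge0 k'.1 s' k'.2; rewrite /=; lra.
have [s Ss] := S_ex.
by exists (tag_d t k.1 k.2 s + interp t s s + tag_d t k'.1 s k'.2); exists s, s.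
Qed.

Lemma bridge_le k k' s s' : S s -> S s' ->
  bridge t k k' <= tag_d t k.1 k.2 s + interp t s s' + tag_d t k'.1 s' k'.2.
Proof.
move=> Ss Ss'; apply: ge_inf; first by have [] := bridge_has_inf k k'.
by exists s, s'.
Qed.

Lemma bridge_ge k k' c :
  (forall s s', S s -> S s' ->
     c <= tag_d t k.1 k.2 s + interp t s s' + tag_d t k'.1 s' k'.2) -> c <= bridge t k k'.
Proof.
move=> H; apply: lb_le_inf; first by have [] := bridge_has_inf k k'.
by move=> _ [s [s' [Ss Ss' ->]]]; exact: H.
Qed.

Lemma bridge_sym k k' : bridge t k k' = bridge t k' k.
Proof.
rewrite /bridge; congr inf.
apply/seteqP; split => l [s [s' [Ss Ss' ->]]]; exists s', s; split => //.
  rewrite (tag_d_sym _ k.2) (tag_d_sym _ s' k'.2); have /= := tag_d_sym None s s'; lra.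
rewrite (tag_d_sym _ k'.2) (tag_d_sym _ s' k.2); have /= := tag_d_sym None s s'; lra.
Qed.

Lemma tag_gap_ge0 th o : 0 <= th -> 0 <= tag_gap th t o.
Proof.
move: t01 => /andP[t0 t1] th0; case: o => [[]|] //=; rewrite !mulr_ge0//; lra.
Qed.

(** The only place where the value 1/2 matters: two gaps pay for exchanging the metric of a side
    with the interpolated one. *)
Lemma tag_gap_cmp th o s s' : 2^-1 <= th -> S s -> S s' ->
  `|tag_d t o s s' - interp t s s'| <= 2 * tag_gap th t o.
Proof.
move: t01 => /andP[t0 t1] th2 Ss Ss'; have := rho_dis Ss Ss'.
have u0 : 0 <= 1 - t by lra.
have A : t * D <= 2 * (th * t * D).
  have := ler_wpM2r (mulr_ge0 t0 D_ge0) th2; rewrite mulrA; lra.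
have B : (1 - t) * D <= 2 * (th * (1 - t) * D).
  have := ler_wpM2r (mulr_ge0 u0 D_ge0) th2; rewrite mulrA; lra.
case: o => [[]|] /= H; rewrite /interp.
- apply: le_trans B.
  have -> : rho true s s' - ((1 - t) * rho false s s' + t * rho true s s') =
     (1 - t) * - (rho false s s' - rho true s s') by ring.
  by rewrite normrM normrN (ger0_norm u0) ler_wpM2l.
- apply: le_trans A.
  have -> : rho false s s' - ((1 - t) * rho false s s' + t * rho true s s') =
     t * (rho false s s' - rho true s s') by ring.
  by rewrite normrM (ger0_norm t0) ler_wpM2l.
- by rewrite subrr normr0 mulr0.
Qed.

Variable th : R.
Hypothesis th2 : 2^-1 <= th.

(** Concatenating the routes gives two crossing points joined through [k2] in the metric of its
    side. Replacing this detour by the interpolated metric costs two gaps, and the glued distances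
    pay the gap of [k2] twice. *)
Lemma bridge_tri k1 k2 k3 :
  bridge t k1 k3 <= bridge t k1 k2 + 2 * tag_gap th t k2.1 + bridge t k2 k3.
Proof.
suff : bridge t k1 k3 - bridge t k2 k3 - 2 * tag_gap th t k2.1 <= bridge t k1 k2 by lra.
apply: bridge_ge => s s' Ss Ss'.
set c := (X in _ <= X).
suff : bridge t k1 k3 - 2 * tag_gap th t k2.1 - c <= bridge t k2 k3 by lra.
apply: bridge_ge => u u' Su Su'; rewrite /c.
have := bridge_le k1 k3 Ss Su'.
have := tag_d_tri None s s' u'; have := tag_d_tri None s' u u'; rewrite /=.
have := tag_d_tri k2.1 s' k2.2 u.
by have := tag_gap_cmp k2.1 th2 Ss' Su; rewrite ler_norml => /andP[? ?]; lra.
Qed.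

Lemma tag_d_bridge k k' : k.1 = k'.1 ->
  tag_d t k.1 k.2 k'.2 <= 2 * tag_gap th t k.1 + bridge t k k'.
Proof.
move=> kk; rewrite -lerBlDl; apply: bridge_ge => s s' Ss Ss'; rewrite -kk.
have := tag_d_tri k.1 k.2 s k'.2; have := tag_d_tri k.1 s s' k'.2.
by have := tag_gap_cmp k.1 th2 Ss Ss'; rewrite ler_norml => /andP[? ?]; lra.
Qed.

Lemma bridge_lip1 k1 k2 k3 : k1.1 = k2.1 ->
  bridge t k1 k3 <= tag_d t k1.1 k1.2 k2.2 + bridge t k2 k3.
Proof.
move=> k12; rewrite -lerBlDl; apply: bridge_ge => s s' Ss Ss'; rewrite -k12.
by have := bridge_le k1 k3 Ss Ss'; have := tag_d_tri k1.1 k1.2 k2.2 s; lra.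
Qed.

Lemma glued_d_sym k k' : glued_d th t k k' = glued_d th t k' k.
Proof.
rewrite /glued_d eq_sym; case: eqP => [->|_]; first by rewrite tag_d_sym.
by rewrite bridge_sym (addrC (tag_gap _ _ _)).
Qed.

Lemma glued_d_tri k1 k2 k3 : glued_d th t k1 k3 <= glued_d th t k1 k2 + glued_d th t k2 k3.
Proof.
have th0 : 0 <= th by apply: le_trans th2; rewrite invr_ge0.
have g1 := tag_gap_ge0 k1.1 th0; have g2 := tag_gap_ge0 k2.1 th0.
have g3 := tag_gap_ge0 k3.1 th0.
have bt := bridge_tri k1 k2 k3.
rewrite /glued_d.
have [e12|n12] := eqVneq k1.1 k2.1; have [e23|n23] := eqVneq k2.1 k3.1.
- by rewrite e12 e23 eqxx; exact: tag_d_tri.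
- rewrite e12 (negbTE n23); have := bridge_lip1 k3 e12; rewrite e12; lra.
- rewrite -e23 (negbTE n12).
  have := bridge_lip1 k1 (esym e23); rewrite -e23 ![bridge _ _ k1]bridge_sym.
  by rewrite (tag_d_sym _ k3.2) -!addrA !lerD2l [X in _ -> _ <= X]addrC; apply.
- have [e13|n13] := eqVneq k1.1 k3.1; last lra.
  by have := tag_d_bridge e13; rewrite -e13; lra.
Qed.

End fixed_time.

Lemma interp_lip t t' x y : S x -> S y -> interp t x y <= interp t' x y + `|t - t'| * D.
Proof.
move=> Sx Sy; have := rho_dis Sx Sy.
have -> : interp t x y = interp t' x y + (t - t') * - (rho false x y - rho true x y).
  by rewrite /interp; ring.
rewrite lerD2l => H; apply: le_trans (ler_norm _) _.
by rewrite normrM normrN ler_wpM2l.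
Qed.

Section varying_time.
Variables t t' : R.
Hypothesis t01 : 0 <= t <= 1.
Hypothesis t01' : 0 <= t' <= 1.

Lemma bridge_lip_mixed c x y : S y ->
  bridge t (Some c, x) (None, y) <= bridge t' (Some c, x) (None, y) + `|t - t'| * D.
Proof.
move=> Sy; rewrite -lerBlDr; apply: (bridge_ge t01') => s s' Ss Ss' /=.
have := bridge_le t01 (Some c, x) (None, y) Ss Sy.
have := interp_lip t t' Ss Sy; have := tag_d_tri t01' None s s' y.
have := tag_d_xx t None y; rewrite /=; lra.
Qed.

Lemma bridge_lip_tagged c c' x y :
  bridge t (Some c, x) (Some c', y) <= bridge t' (Some c, x) (Some c', y) + `|t - t'| * D.
Proof.
rewrite -lerBlDr; apply: (bridge_ge t01') => s s' Ss Ss' /=.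
have := bridge_le t01 (Some c, x) (Some c', y) Ss Ss'.
by have := interp_lip t t' Ss Ss'; rewrite /=; lra.
Qed.

(* If [interp t s y] exceeds [interp t' s y], then [rho c s y <= interp t' s y], so the
   detour through [s] may be replaced by the direct jump at [y]. *)
Lemma bridge_mono c x y : S y ->
  (if c then t <= t' else t' <= t) ->
  bridge t (Some c, x) (None, y) <= bridge t' (Some c, x) (None, y).
Proof.
move=> Sy tt'; apply: (bridge_ge t01') => s s' Ss Ss' /=.
have := bridge_le t01 (Some c, x) (None, y) Ss Sy.
have := bridge_le t01 (Some c, x) (None, y) Sy Sy.
have := tag_d_tri t01' None s s' y.
have := tag_d_xx t None y; have := rho_tri c x s y; rewrite /= => ? -> ? ? ?.
have : interp t s y <= interp t' s y \/ rho c s y <= interp t' s y.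
  move: t01 t01' => /andP[t0 t1] /andP[t0' t1']; rewrite /interp.
  have u0' : 0 <= 1 - t' by lra.
  have [le|/ltW le] := leP (rho (~~ c) s y) (rho c s y).
    left; rewrite -subr_ge0; case: {+}c tt' le => /= tt' le.
      rewrite (_ : _ - _ = (t' - t) * (rho true s y - rho false s y)); last by ring.
      by apply: mulr_ge0; lra.
    rewrite (_ : _ - _ = (t - t') * (rho false s y - rho true s y)); last by ring.
    by apply: mulr_ge0; lra.
  right; rewrite -subr_ge0; case: {+}c tt' le => /= tt' le.
    rewrite (_ : _ - _ = (1 - t') * (rho false s y - rho true s y)); last by ring.
    by apply: mulr_ge0; lra.
  rewrite (_ : _ - _ = t' * (rho true s y - rho false s y)); last by ring.
  by apply: mulr_ge0; lra.
by case; lra.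
Qed.

Variable th : R.
Hypothesis th01 : 2^-1 <= th <= 1.

(** The two variations never add up. If the gap is no larger at [t], the Lipschitz bound for the
    bridge suffices; if it is larger, it exceeds the other by at most th |t - t'| D, which [th <= 1]
    absorbs, while the bridge is no longer at [t] by monotonicity. *)
Lemma glued_d_lip_mixed c x y : S y ->
  glued_d th t (Some c, x) (None, y) <= glued_d th t' (Some c, x) (None, y) + `|t - t'| * D.
Proof.
move=> Sy; rewrite /glued_d /= !addr0.
have L := @bridge_lip_mixed c x y Sy; have M := @bridge_mono c x y Sy.
have th0 : 0 <= th by case/andP: th01 => h _; apply: le_trans h; rewrite invr_ge0.
have th1 : th <= 1 by case/andP: th01.
have H a : 0 <= a -> 0 <= th * a * D <= a * D.
  move=> a0; rewrite !mulr_ge0//= ler_wpM2r//.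
  by rewrite -[leRHS]mul1r ler_wpM2r.
have [tt'|/ltW tt'] := leP t t'.
  have /H/andP[h0 h1] : 0 <= t' - t by lra.
  rewrite distrC ger0_norm ?subr_ge0// in L *.
  case: c L M => /= L M; last by move: h0 h1; rewrite mulrBr !mulrBl; lra.
  have := M tt'; move: h0 h1; rewrite !mulrBr !mulrBl; lra.
have /H/andP[h0 h1] : 0 <= t - t' by lra.
rewrite ger0_norm ?subr_ge0// in L *.
case: c L M => /= L M; first by move: h0 h1; rewrite !mulrBr !mulrBl; lra.
have := M tt'; move: h0 h1; rewrite !mulrBr !mulrBl; lra.
Qed.

Lemma glued_d_lip k k' : (k.1 = None -> S k.2) -> (k'.1 = None -> S k'.2) ->
  glued_d th t k k' <= glued_d th t' k k' + `|t - t'| * D.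
Proof.
case: k k' => [u x] [u' y] /= Sx Sy.
have D0 : 0 <= `|t - t'| * D by rewrite mulr_ge0.
case: u u' Sx Sy => [c|] [c'|] /= Sx Sy.
- have [->|cc'] := eqVneq c c'; first by rewrite /glued_d eqxx lerDl.
  rewrite /glued_d; case: eqP => [[E]|_]; first by rewrite E eqxx in cc'.
  rewrite /fst /snd.
  (* For opposite sides the gaps have a constant sum, so only the bridge varies. *)
  have G u : tag_gap th u (Some c) + tag_gap th u (Some c') = th * D.
    by case: {+}c {+}c' cc' => [] [] //= _; ring.
  by rewrite !G; have := bridge_lip_tagged c c' x y; lra.
- by apply: glued_d_lip_mixed; exact: Sy.
- rewrite (glued_d_sym t) (glued_d_sym t' th (None, x)).
  by apply: glued_d_lip_mixed; exact: Sx.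
- by rewrite /glued_d eqxx /=; apply: interp_lip; [exact: Sx|exact: Sy].
Qed.

End varying_time.

Lemma glued_d_lip_norm th t t' k k' : 2^-1 <= th <= 1 -> 0 <= t <= 1 -> 0 <= t' <= 1 ->
  (k.1 = None -> S k.2) -> (k'.1 = None -> S k'.2) ->
  `|glued_d th t k k' - glued_d th t' k k'| <= `|t - t'| * D.
Proof.
move=> th01 t01 t01' Sk Sk'; rewrite ler_norml.
have := glued_d_lip t01 t01' th01 Sk Sk'; have := glued_d_lip t01' t01 th01 Sk Sk'.
by rewrite (distrC t' t) => ? ?; apply/andP; split; lra.
Qed.

Lemma glued_d_le th th' t k k' : 0 <= t <= 1 -> th <= th' ->
  glued_d th t k k' <= glued_d th' t k k'.
Proof.
move=> /andP[t0 t1] tt'; rewrite /glued_d; case: ifP => // _; rewrite lerD2r.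
have G o : tag_gap th t o <= tag_gap th' t o.
  by case: o => [[]|] //=; rewrite ler_wpM2r// ler_wpM2r// subr_ge0.
exact: lerD.
Qed.

Lemma glued_d_opposite th th' t x y :
  glued_d th' t (Some false, x) (Some true, y) =
  glued_d th t (Some false, x) (Some true, y) + (th' - th) * D.
Proof. by rewrite /glued_d /=; ring. Qed.

End glued_metric.

(** * Sweeping the remainder by mass *)

Section sweep.
Context {R : realType} (Rem : set R).
Local Notation RR := (measurableTypeR R).
Hypothesis mRem : measurable Rem.
Hypothesis RemU : Rem `<=` `[0, 1[.

Lemma leb_fin (A : set R) : measurable A -> A `<=` `[0, 1[ ->
  lebesgue_measure A \is a fin_num.
Proof.
move=> mA AU; rewrite ge0_fin_numE//; apply: (@le_lt_trans _ _ 1%E); last exact: ltry.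
rewrite -(@lebU_setT R) lebUE setIT; by apply: le_measure; rewrite ?inE.
Qed.

(** The distribution function of Lebesgue measure on [Rem]; its level sets are used to cut off a
    prescribed proportion of [Rem]. *)
Definition sweep (p : R) : R := fine (lebesgue_measure (Rem `&` `]-oo, p[)).

Let mRemI (i : interval R) : measurable (Rem `&` [set` i]).
Proof. by apply: measurableI => //; exact: measurable_itv. Qed.

Let RemIU (i : interval R) : Rem `&` [set` i] `<=` `[0, 1[.
Proof. by move=> s [/RemU]. Qed.

Lemma sweepE p : (sweep p)%:E = lebesgue_measure (Rem `&` `]-oo, p[).
Proof. by rewrite /sweep fineK// leb_fin. Qed.

Lemma sweep_sub p q : p <= q ->
  lebesgue_measure (Rem `&` `[p, q[) = (sweep q - sweep p)%:E.
Proof.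
move=> pq; have E : Rem `&` `]-oo, q[ = (Rem `&` `]-oo, p[) `|` (Rem `&` `[p, q[).
  apply/seteqP; split => s; rewrite /= !in_itv /=.
    by move=> [Rs ->]; have [sp|ps] := ltP s p; [left|right].
  by move=> [[Rs sp]|[Rs /andP[ps sq]]]; split => //; exact: lt_le_trans pq.
have : (sweep q)%:E = ((sweep p)%:E + lebesgue_measure (Rem `&` `[p, q[))%E.
  rewrite !sweepE E; apply: measureU; [exact: mRemI|exact: mRemI|].
  by apply/seteqP; split => s //=; rewrite !in_itv /= => -[[_ sp] [_ /andP[+ _]]]; rewrite leNgt sp.
have := @leb_fin _ (mRemI `[p, q[) (@RemIU `[p, q[).
move: (lebesgue_measure _) => x; case: x => [x||] // _ [->].
by congr EFin; ring.
Qed.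

Lemma sweep_nd p q : p <= q -> sweep p <= sweep q.
Proof. by move=> pq; rewrite -subr_ge0 -lee_fin -sweep_sub// measure_ge0. Qed.

Lemma sweep_lip p q : p <= q -> sweep q - sweep p <= q - p.
Proof.
move=> pq; rewrite -lee_fin -sweep_sub//.
apply: (@le_trans _ _ (lebesgue_measure (`[p, q[%classic : set R))).
  by apply: le_measure; rewrite ?inE//; exact: mRemI.
rewrite lebesgue_measure_itv /= lte_fin; case: ifP => // _.
by rewrite lee_fin subr_ge0.
Qed.

Lemma sweep_ge0 p : 0 <= sweep p.
Proof. by rewrite -lee_fin sweepE. Qed.

Lemma sweep_le p : ((sweep p)%:E <= lebesgue_measure Rem)%E.
Proof. by rewrite sweepE; apply: le_measure; rewrite ?inE//; exact: mRemI. Qed.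

Lemma measurable_sweep_lt c : measurable [set p | sweep p < c].
Proof.
have /is_intervalP-> : is_interval [set p | sweep p < c]; last exact: measurable_itv.
move=> x y /= xc yc z /andP[xz zy].
exact: le_lt_trans (sweep_nd zy) yc.
Qed.

Lemma measurable_slab (a b : R) : measurable (Rem `&` [set p | a <= sweep p < b]).
Proof.
rewrite (_ : _ `&` _ = (Rem `&` [set p | sweep p < b]) `\` [set p | sweep p < a]).
  apply: measurableD; last exact: measurable_sweep_lt.
  by apply: measurableI => //; exact: measurable_sweep_lt.
apply/seteqP; split => s /=.
  by move=> [Rs /andP[as_ sb]]; split => //; apply/negP; rewrite -leNgt.
by move=> [[Rs sb] /negP]; rewrite -leNgt => as_; rewrite as_ sb.
Qed.

(** The slab lies between its infimum and its supremum, where by continuity [sweep] still takes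
    values in [a, b]; the supremum may belong to the slab but is a single point, hence null. *)
Lemma sweep_slab (a b : R) : a <= b ->
  (lebesgue_measure (Rem `&` [set p | (a <= sweep p < b)%R]) <= (b - a)%:E)%E.
Proof.
move=> ab; pose J := Rem `&` [set p | a <= sweep p < b].
have mJ : measurable J := measurable_slab a b.
have [J0|/set0P Jn] := eqVneq J set0.
  by rewrite -/J J0 measure0 lee_fin subr_ge0.
have Jb : has_sup J by split => //; exists 1 => s [/RemU]; rewrite /= in_itv /= => /andP[_ /ltW].
have Jl : has_inf J by split => //; exists 0 => s [/RemU]; rewrite /= in_itv /= => /andP[].
have al : a <= sweep (inf J).
  apply/ler_addgt0Pr => e e0; have [s Js se] := inf_adherent e0 Jl.
  have is_ : inf J <= s by apply: ge_inf => //; case: Jl.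
  have [_ /= /andP[as_ _]] := Js.
  by have := sweep_lip is_; lra.
have bl : sweep (sup J) <= b.
  apply/ler_addgt0Pr => e e0; have [s Js se] := sup_adherent e0 Jb.
  have ss : s <= sup J by apply: ub_le_sup => //; case: Jb.
  have [_ /= /andP[_ sb]] := Js.
  by have := sweep_lip ss; lra.
have [j Jj] := Jn.
have ij : inf J <= sup J.
  by apply: (@le_trans _ _ j); [apply: ge_inf => //; case: Jl|apply: ub_le_sup => //; case: Jb].
have : (lebesgue_measure J <= lebesgue_measure (Rem `&` `[inf J, sup J[) + lebesgue_measure [set sup J])%E.
  apply: (@le_trans _ _ (lebesgue_measure ((Rem `&` `[inf J, sup J[) `|` [set sup J]))).
    apply: le_measure; rewrite ?inE//; first by apply: measurableU => //; exact: mRemI.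
    move=> s Js; have is_ : inf J <= s by apply: ge_inf => //; case: Jl.
    have : s <= sup J by apply: ub_le_sup => //; case: Jb.
    rewrite le_eqVlt => /orP[/eqP->|sJ]; first by right.
    by left; split; [case: Js|rewrite /= in_itv /= is_].
  by apply: measureU2 => //; exact: mRemI.
rewrite lebesgue_measure_set1 adde0 sweep_sub// => H; apply: le_trans H _.
by rewrite lee_fin; lra.
Qed.

End sweep.

(** * The path of spaces between the two ends *)

Section interpolation.
Context {R : realType} (X0 X1 : mmspace R) (phi0 : R -> mm_car X0) (phi1 : R -> mm_car X1).
Variables (S : set R) (D : R).
Hypothesis par0 : mm_parameter X0 phi0.
Hypothesis par1 : mm_parameter X1 phi1.
Hypothesis mS : measurable S.
Hypothesis SU : S `<=` `[0, 1[.
Hypothesis S_ex : exists s, S s.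

Definition pull_d (c : bool) (s t : R) : R :=
  if c then mm_d X1 (phi1 s) (phi1 t) else mm_d X0 (phi0 s) (phi0 t).

Hypothesis S_dis : forall s t, S s -> S t -> `|pull_d false s t - pull_d true s t| <= D.

Local Notation RR := (measurableTypeR R).

Let Rem : set R := `[0, 1[ `\` S.

Definition rem_mass : R := fine (lebesgue_measure Rem).

Hypothesis rem_gt0 : 0 < rem_mass.
Hypothesis rem_le : rem_mass <= D.

Let D_ge0 : 0 <= D.
Proof. exact/ltW/(lt_le_trans rem_gt0). Qed.

Let mRem : measurable Rem.
Proof. by apply: measurableD => //; exact: measurable_itv. Qed.

Let RemU : Rem `<=` `[0, 1[.
Proof. by move=> s []. Qed.

Lemma rem_massE : (rem_mass%:E = lebesgue_measure Rem)%E.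
Proof. by rewrite /rem_mass fineK// leb_fin. Qed.

(** The clause [1 <= t] matters at time 1: [sweep] may reach [rem_mass] on a null part of [Rem],
    which would otherwise stay in [X0] and spoil the exact endpoint. *)
Definition point_tag (t p : R) : option bool :=
  if `[< S p >] then None else Some ((sweep Rem p < t * rem_mass) || (1 <= t)).

Lemma tag_S t p : S p -> point_tag t p = None.
Proof. by move=> Sp; rewrite /point_tag asboolT. Qed.

Lemma tag_NS t p : ~ S p -> point_tag t p = Some ((sweep Rem p < t * rem_mass) || (1 <= t)).
Proof. by move=> Sp; rewrite /point_tag asboolF. Qed.

Lemma tag_None t p : point_tag t p = None -> S p.
Proof. by have [//|/(tag_NS t) ->] := pselect (S p). Qed.

Lemma measurable_tag t u : measurable [set p | point_tag t p = u].
Proof.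
have mT : measurable [set p | point_tag t p = Some true].
  have [t1|t1] := leP 1 t.
    rewrite (_ : [set _ | _] = ~` S); first exact: measurableC.
    apply/seteqP; split => p /=; first by move=> + Sp; rewrite tag_S.
    by move=> Sp; rewrite tag_NS// t1 orbT.
  rewrite (_ : [set _ | _] = [set p | sweep Rem p < t * rem_mass] `\` S).
    by apply: measurableD => //; exact: measurable_sweep_lt.
  apply/seteqP; split => p /=.
    have [Sp|Sp] := pselect (S p); first by rewrite tag_S.
    by rewrite tag_NS// => -[] /orP[//|]; rewrite leNgt t1.
  by move=> [pm Sp]; rewrite tag_NS// pm.
case: u => [[]|] //.
  rewrite (_ : [set _ | _] = ~` S `\` [set p | point_tag t p = Some true]).
    by apply: measurableD => //; exact: measurableC.
  apply/seteqP; split => p /=.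
    by move=> tp; split; [move=> Sp; move: tp; rewrite tag_S|rewrite tp].
  by move=> [Sp]; rewrite tag_NS//; case: (_ || _).
rewrite (_ : [set _ | _] = S)//; apply/seteqP; split => p /=; first exact: tag_None.
exact: tag_S.
Qed.

Lemma pull_d_xx c x : pull_d c x x = 0.
Proof. by case: c; exact: mm_dxx. Qed.

Lemma pull_d_sym c x y : pull_d c x y = pull_d c y x.
Proof. by case: c; exact: mm_d_sym. Qed.

Lemma pull_d_tri c x y z : pull_d c x z <= pull_d c x y + pull_d c y z.
Proof. by case: c; exact: mm_d_tri. Qed.

Section one_time.
Variable t : R.

Let tag_cell (q : option bool * nat * nat * nat) : set R :=
  let: (u, i, j, k) := q in [set y | [/\ point_tag t y = u,
    mm_d X0 (phi0 y) (dense_pt X0 i) < mesh k & mm_d X1 (phi1 y) (dense_pt X1 j) < mesh k]].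

Lemma measurable_tag_cell q : measurable (`[0, 1[ `&` tag_cell q).
Proof.
case: q => [[[u i] j] k]; rewrite (_ : _ `&` _ = [set y | point_tag t y = u] `&`
   ((`[0, 1[ `&` phi0 @^-1` [set x | mm_d X0 (dense_pt X0 i) x < mesh k]) `&`
   (`[0, 1[ `&` phi1 @^-1` [set x | mm_d X1 (dense_pt X1 j) x < mesh k]))).
  apply: measurableI; first exact: measurable_tag.
  apply: measurableI; [apply: par0.1|apply: par1.1]; apply: mm_borel_open; exact: d_open_ball.
apply/seteqP; split => s /=; rewrite ![mm_d _ (dense_pt _ _) _]mm_d_sym.
  by move=> [? [? ? ?]].
by move=> [? [[? ?] [? ?]]].
Qed.

Lemma tag_cell_ex y k : exists i j, tag_cell (point_tag t y, i, j, k) y.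
Proof.
have [i iP] := dense_ptP (phi0 y) (@mesh_gt0 R k).
have [j jP] := dense_ptP (phi1 y) (@mesh_gt0 R k).
by exists i, j.
Qed.

Lemma tag_cell_close u i j k x y : tag_cell (u, i, j, k) x -> tag_cell (u, i, j, k) y ->
  [/\ point_tag t x = point_tag t y, pull_d false x y < 2 * mesh k & pull_d true x y < 2 * mesh k].
Proof.
move=> [ux x0 x1] [uy y0 y1]; split; first by rewrite ux uy.
  have := mm_d_tri (phi0 x) (dense_pt X0 i) (phi0 y).
  by rewrite /pull_d (mm_d_sym (dense_pt X0 i)); lra.
have := mm_d_tri (phi1 x) (dense_pt X1 j) (phi1 y).
by rewrite /pull_d (mm_d_sym (dense_pt X1 j)); lra.
Qed.

(** The tag together with the two pulled back metrics defines a topology for which the cells form a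
    countable base. Balls of every [path_d] at time [t] are open in it, which gives their
    measurability. *)
Lemma measurable_tag_open (A : set R) :
  (forall x, A x -> exists2 r, 0 < r & forall y, point_tag t x = point_tag t y ->
     pull_d false x y < r -> pull_d true x y < r -> A y) ->
  measurable (`[0, 1[ `&` A).
Proof.
move=> oA.
pose F q : set R := if `[< tag_cell q `<=` A >] then `[0, 1[ `&` tag_cell q else set0.
have -> : `[0, 1[ `&` A = \bigcup_q F q.
  apply/seteqP; split => x.
    move=> [x01 /oA[r r0 rA]]; have [k kr] : exists k, mesh k < r / 2.
      by apply: mesh_small; lra.
    have [i [j xij]] := tag_cell_ex x k; exists (point_tag t x, i, j, k) => //.
    rewrite /F asboolT//= => y yij; have [ty y0 y1] := tag_cell_close xij yij.
    by apply: rA => //; lra.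
  move=> [q _]; rewrite /F; case: asboolP => // qA [x01 qx].
  by split => //; exact: qA.
apply: countable_bigcupT_measurable; first exact: countableP.
by move=> q; rewrite /F; case: ifP => // _; exact: measurable_tag_cell.
Qed.

Lemma tag_dense : exists p : nat -> R, forall x e, 0 < e -> exists n,
  [/\ point_tag t x = point_tag t (p n), pull_d false x (p n) < e & pull_d true x (p n) < e].
Proof.
(* One point is picked from each non-empty cell; the value 0 for the other indices is harmless. *)
pose p n : R := if @pickle_inv (option bool * nat * nat * nat)%type n is Some q
  then xget 0 (tag_cell q) else 0.
exists p => x e e0; have [k ke] : exists k, mesh k < e / 2 by apply: mesh_small; lra.
have [i [j xij]] := tag_cell_ex x k; exists (pickle (point_tag t x, i, j, k)).
rewrite /p pickleK_inv.
have := xgetI 0 xij; set y := xget _ _ => yij.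
have [ty y0 y1] := tag_cell_close xij yij; split => //; lra.
Qed.

End one_time.

Definition path_d (th t : R) (x y : R) : R :=
  glued_d pull_d S D th t (point_tag t x, x) (point_tag t y, y).

Lemma path_space_exists th t : 2^-1 <= th -> 0 <= t <= 1 ->
  exists (X : mmspace R) (phi : R -> mm_car X),
    mm_parameter X phi /\ forall x y, mm_d X (phi x) (phi y) = path_d th t x y.
Proof.
move=> th2 t01; have [p pP] := tag_dense t.
have lt_r x y r : point_tag t x = point_tag t y -> pull_d false x y < r -> pull_d true x y < r ->
    path_d th t x y < r.
  move=> txy H0 H1; rewrite /path_d /glued_d /= txy eqxx.
  exact: (tag_d_lt t01).
have tri x y z : path_d th t x z <= path_d th t x y + path_d th t y z.
  exact: (glued_d_tri pull_d_xx pull_d_sym pull_d_tri S_ex D_ge0 S_dis t01 th2).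
apply: (@pseudometric_mmspace R (path_d th t) p).
- by move=> x y; exact: (glued_d_sym S D pull_d_sym t th).
- exact: tri.
- move=> x e e0; have [n [tx x0 x1]] := pP x e e0; exists n; exact: lt_r.
- move=> x r; apply: (@measurable_tag_open t) => y /= xy.
  exists (r - path_d th t x y); first by rewrite subr_gt0.
  by move=> z tz z0 z1; have := lt_r _ _ _ tz z0 z1; have := tri x y z; lra.
Qed.

(** At the end [c] the gap of side [c] is 0 and the interpolated metric is that of side [c], so the
    triangle inequality collapses the bridge to a direct distance. *)
Lemma glued_d_end (c : bool) th k k' :
  (k.1 = None -> S k.2) -> (k'.1 = None -> S k'.2) ->
  k.1 \in [:: None; Some c] -> k'.1 \in [:: None; Some c] ->
  glued_d pull_d S D th c%:R k k' = pull_d c k.2 k'.2.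
Proof.
have c01 : 0 <= (c%:R : R) <= 1 by case: c; rewrite ?lexx ler01.
have iE x y : interp pull_d c%:R x y = pull_d c x y.
  by rewrite /interp; case: {+}c => /=; rewrite ?mulr1n ?mulr0n; ring.
have gE : tag_gap D th c%:R (Some c) = 0 by case: {+}c => /=; rewrite ?mulr1n ?mulr0n; ring.
have mix x y : S y -> bridge pull_d S c%:R (Some c, x) (None, y) = pull_d c x y.
  move=> Sy; apply/eqP; rewrite eq_le; apply/andP; split.
    have := bridge_le pull_d_xx pull_d_sym pull_d_tri S_ex c01 (Some c, x) (None, y) Sy Sy.
    by rewrite /= iE pull_d_xx !addr0.
  apply: (bridge_ge pull_d_xx pull_d_sym pull_d_tri S_ex c01) => s s' _ _ /=.
  rewrite !iE; have := pull_d_tri c x s y; have := pull_d_tri c s s' y; lra.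
have mixed x y : S y ->
    glued_d pull_d S D th c%:R (Some c, x) (None, y) = pull_d c x y.
  move=> Sy; transitivity
    (tag_gap D th c%:R (Some c) + 0 + bridge pull_d S c%:R (Some c, x) (None, y)) => //.
  by rewrite gE !add0r mix.
case: k k' => [u x] [v y] /= Sx Sy.
rewrite !inE => /orP[/eqP uE|/eqP uE] /orP[/eqP vE|/eqP vE]; rewrite uE vE.
- exact: iE.
- by rewrite (glued_d_sym S D pull_d_sym) mixed; [exact: pull_d_sym|exact: Sx].
- by apply: mixed; exact: Sy.
- by rewrite /glued_d eqxx.
Qed.

Lemma tag_end (c : bool) x : point_tag c%:R x \in [:: None; Some c].
Proof.
have [Sx|Sx] := pselect (S x); first by rewrite tag_S// !inE eqxx.
rewrite tag_NS// !inE; case: c => /=; first by rewrite lexx orbT.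
by rewrite mul0r ltNge sweep_ge0//= ler10 eqxx.
Qed.

Lemma path_d_end (c : bool) th x y : path_d th c%:R x y = pull_d c x y.
Proof.
by rewrite /path_d glued_d_end //; [exact: tag_None|exact: tag_None|exact: tag_end|exact: tag_end].
Qed.

Lemma path_d_lip th s t x y : 2^-1 <= th <= 1 -> 0 <= s <= 1 -> 0 <= t <= 1 ->
  point_tag s x = point_tag t x -> point_tag s y = point_tag t y ->
  `|path_d th s x y - path_d th t x y| <= `|s - t| * D.
Proof.
move=> th01 s01 t01 tx ty; rewrite /path_d tx ty.
by apply: (glued_d_lip_norm pull_d_xx pull_d_sym pull_d_tri S_ex D_ge0 S_dis) => //;
  exact: tag_None.
Qed.

Lemma path_d_le th th' t x y : 0 <= t <= 1 -> th <= th' -> path_d th t x y <= path_d th' t x y.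
Proof. exact: glued_d_le. Qed.

Lemma path_d_lt th th' t x y : th < th' -> point_tag t x = Some false -> point_tag t y = Some true ->
  path_d th t x y < path_d th' t x y.
Proof.
move=> tt' tx ty; rewrite /path_d tx ty (glued_d_opposite _ _ _ th th') ltrDl mulr_gt0 ?subr_gt0//.
exact: lt_le_trans rem_le.
Qed.

Definition tagged (t : R) (b : bool) : set R := `[0, 1[ `&` [set p | point_tag t p = Some b].

Lemma measurable_tagged t b : measurable (tagged t b).
Proof. by apply: measurableI; [exact: measurable_itv|exact: measurable_tag]. Qed.

(** Slabs bound the mass of either side from above by less than [rem_mass]. Since both sides
    together make up [Rem], neither can be null. *)
Lemma tagged_mass_gt0 t : 0 < t < 1 ->
  (0 < lebesgue_measure (tagged t true))%E /\ (0 < lebesgue_measure (tagged t false))%E.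
Proof.
move=> /andP[t0 t1]; pose A := tagged t.
have mA b : measurable (A b) := measurable_tagged t b.
have AR b : A b `<=` Rem.
  by move=> p [p01 /= tp]; split => // Sp; move: tp; rewrite tag_S.
have tagR p : Rem p -> point_tag t p = Some (sweep Rem p < t * rem_mass).
  by move=> [_ Sp]; rewrite tag_NS// (leNgt 1 t) t1 orbF.
have E : A true `|` A false = Rem.
  apply/seteqP; split => p; first by case=> /AR.
  move=> Rp; have := tagR p Rp; rewrite /A; case: (_ < _) => tp; [left|right];
    split => //; exact: RemU.
have M : (lebesgue_measure (A true) + lebesgue_measure (A false) = rem_mass%:E)%E.
  rewrite rem_massE -E; apply/esym/measureU; [exact: mA|exact: mA|].
  by apply/seteqP; split => p // -[[_ /= tp] [_ /=]]; rewrite tp.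
have tm0 : 0 < t * rem_mass by rewrite mulr_gt0.
have tm1 : 0 < (1 - t) * rem_mass by rewrite mulr_gt0 ?subr_gt0.
have upT : (lebesgue_measure (A true) <= (t * rem_mass)%:E)%E.
  rewrite -[X in X%:E]subr0; apply: le_trans (sweep_slab mRem RemU (ltW tm0)).
  apply: le_measure; rewrite ?inE; [exact: mA|exact: (measurable_slab mRem RemU)|].
  move=> p Ap; have Rp := AR _ _ Ap; split => //=; rewrite sweep_ge0//=.
  by case: Ap => _ /=; rewrite tagR// => -[].
(* The slack [e] is there because [sweep] may equal [rem_mass], while slabs are open on the
   right. *)
have upF e : 0 < e -> (lebesgue_measure (A false) <= (rem_mass + e - t * rem_mass)%:E)%E.
  move=> e0; have le : t * rem_mass <= rem_mass + e by move: tm1; rewrite mulrBl; lra.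
  apply: le_trans (sweep_slab mRem RemU le).
  have sub p : A false p -> Rem p /\ t * rem_mass <= sweep Rem p < rem_mass + e.
    move=> Ap; have Rp := AR _ _ Ap; split => //; apply/andP; split.
      by case: Ap => _ /=; rewrite tagR// => -[]; rewrite leNgt => ->.
    have := sweep_le mRem RemU p; rewrite -rem_massE lee_fin; lra.
  by apply: le_measure; rewrite ?inE; [exact: mA|exact: (measurable_slab mRem RemU)|exact: sub].
have := @leb_fin _ _ (mA true) (@subIsetl _ _ _).
have := @leb_fin _ _ (mA false) (@subIsetl _ _ _).
have := upF (t * rem_mass / 2) ltac:(lra); move: M upT.
rewrite -/A.
move: (lebesgue_measure (A true)) (lebesgue_measure (A false)) => x y.
case: x => [x||] //; case: y => [y||] // [xy]; rewrite !lee_fin => xt yt _ _.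
by rewrite !lte_fin; move: tm1; rewrite mulrBl mul1r => ?; split; lra.
Qed.

Lemma measurable_tag_agree s t : measurable [set p | point_tag s p = point_tag t p].
Proof.
rewrite (_ : [set p | _] = \bigcup_u ([set p | point_tag s p = u] `&` [set p | point_tag t p = u])).
  apply: countable_bigcupT_measurable; first exact: countableP.
  by move=> u; apply: measurableI; exact: measurable_tag.
by apply/seteqP; split => p /=; [move=> E; exists (point_tag s p)|move=> [u _ [/= -> ->]]].
Qed.

(** Points that change side between the two times lie in a slab of mass |s - t| [rem_mass], up to a
    slack [e] needed at time 1, and [rem_mass <= D]. This fixes the size allowed for the
    remainder. *)
Lemma tag_agree_mass s t : 0 <= s <= 1 -> 0 <= t <= 1 ->
  ((1 - `|s - t| * D)%:E <= lebU [set p | point_tag s p = point_tag t p])%E.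
Proof.
wlog st : s t / s <= t.
  move=> H s01 t01; have [st|/ltW ts] := leP s t; first exact: H.
  have := H t s ts t01 s01; rewrite distrC; congr (_ <= lebU _)%E.
  by apply/seteqP; split => p /= ->.
move=> /andP[s0 _] /andP[_ t1].
have mA : @measurable _ RR [set p | point_tag s p = point_tag t p] := measurable_tag_agree s t.
suff H e : 0 < e -> (lebU (~` [set p | point_tag s p = point_tag t p]) <= (`|s - t| * D + e)%:E)%E.
  have := prob_add_setC (@lebU_setT R) mA.
  have : (0 <= lebU [set p | point_tag s p = point_tag t p])%E by exact: measure_ge0.
  have : (0 <= lebU (~` [set p | point_tag s p = point_tag t p]))%E by exact: measure_ge0.
  move: H; move: (lebU _) (lebU _) => x y.
  case: y => [y||] //; case: x => [x||] // H _ _ [xy].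
  rewrite lee_fin; apply/ler_addgt0Pr => e /H; rewrite lee_fin; lra.
move=> e0; rewrite lebUE.
have le : s * rem_mass <= t * rem_mass + e.
  by have := ler_wpM2r (ltW rem_gt0) st; lra.
apply: (@le_trans _ _ (t * rem_mass + e - s * rem_mass)%:E); last first.
  rewrite lee_fin addrAC lerD2r -mulrBl ler0_norm ?subr_le0// opprB.
  by apply: ler_wpM2l => //; rewrite subr_ge0.
apply: le_trans (sweep_slab mRem RemU le).
apply: le_measure; rewrite ?inE.
- by apply: measurableI; [exact: measurable_itv|exact: measurableC].
- exact: (measurable_slab mRem RemU).
move=> p [p01 /= np]; have Sp : ~ S p by move=> Sp; apply: np; rewrite !tag_S.
split => //; move: np; rewrite !tag_NS//.
have pm : sweep Rem p <= rem_mass by rewrite -lee_fin rem_massE sweep_le.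
have [sm|ms] := ltP (sweep Rem p) (s * rem_mass).
  have smt : sweep Rem p < t * rem_mass.
    exact: lt_le_trans sm (ler_wpM2r (ltW rem_gt0) st).
  by rewrite smt /= => np; case: np.
move=> np; rewrite /=.
have [t1'|t1'] := leP 1 t.
  have -> : t = 1 by lra.
  by rewrite mul1r; lra.
have s1 : (1 <= s) = false by apply/negbTE; rewrite -ltNge; lra.
move: np; rewrite s1 orbF /=.
have [tm _|_ np] := ltP (sweep Rem p) (t * rem_mass); last by case: np; rewrite leNgt t1'.
by lra.
Qed.

End interpolation.

(** * An invariant of mm-isomorphism *)

Section ball_mass.
Context {R : realType}.
Implicit Types X Y : mmspace R.

Definition ball_mass X (r : R) (x : mm_car X) : \bar R := mm_mu X [set y | mm_d X x y < r].

Definition heavy X (r c : R) : set (mm_car X) := [set x | (c%:E < ball_mass r x)%E].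

Lemma measurable_ball X x r : measurable ([set y | mm_d X x y < r] : set (mm_sig X)).
Proof. by apply: (@mm_borel_open _ X); exact: d_open_ball. Qed.

(** Open balls are exhausted by smaller concentric ones, so the mass of an [r]-ball is lower
    semicontinuous in its centre. *)
Lemma d_open_heavy X r c : d_open (mm_d X) (@heavy X r c).
Proof.
move=> x xc; pose F n : set (mm_sig X) := [set y | mm_d X x y < r - mesh n].
have mF n : measurable (F n) by exact: measurable_ball.
have UF : \bigcup_n F n = [set y | mm_d X x y < r].
  apply/seteqP; split => y; rewrite /F /=.
    by move=> [n _ /=]; have := @mesh_gt0 R n; lra.
  move=> xy; have [n nr] : exists k, mesh k < r - mm_d X x y by apply: mesh_small; lra.
  by exists n => //=; lra.
have : mmeas (F n) @[n --> \oo] --> mmeas (\bigcup_n F n).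
  apply: nondecreasing_cvg_mu => //; first exact: bigcupT_measurable.
  by move=> m n mn; apply/subsetPset => y; rewrite /F /=; have := @mesh_le R _ _ mn; lra.
rewrite UF => cv.
have xc' : (c%:E < mmeas ([set y | (mm_d X x y < r)%R] : set (mm_sig X)))%E.
  by rewrite mmeasE//; exact: (@measurable_ball X x r).
have [n nc] : exists n, (c%:E < mmeas (F n))%E.
  apply: contrapT => ne; move: xc'; apply/negP; rewrite -leNgt -(cvg_lim _ cv)//.
  apply: lime_le; first by apply/cvg_ex; eexists; exact: cv.
  by apply: nearW => n; rewrite leNgt; apply/negP => nc; apply: ne; exists n.
exists (mesh n); first exact: mesh_gt0.
move=> y xy; rewrite /heavy /ball_mass /=; apply: lt_le_trans nc _.
rewrite -(mmeasE (@measurable_ball X y r)).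
apply: (le_measure (mmeas (X := X))); rewrite ?inE//; first exact: measurable_ball.
by move=> z; rewrite /F /=; have := mm_d_tri y x z; rewrite (mm_d_sym y x); lra.
Qed.

(** For fixed [r], this is the tail distribution of the mass of the [r]-ball around a random
    point. *)
Definition conc X (r c : R) : \bar R := mm_mu X (@heavy X r c).

Lemma mm_iso_conc X Y r c : mm_iso X Y -> conc X r c = conc Y r c.
Proof.
move=> [f [fs isof muf]].
have full A : mm_borel X A -> mm_mu X (mm_supp X `&` A) = mm_mu X A.
  move=> mA; have mS := @mm_borel_supp _ X.
  have mSA : mm_borel X (mm_supp X `&` A) := @measurableI _ (mm_sig X) _ _ mS mA.
  have C0 : mmeas (X := X) (~` mm_supp X) = 0%E.
    rewrite mmeasE; first exact: mm_mu_setC_supp.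
    exact: (@measurableC _ (mm_sig X) _ mS).
  rewrite -(mmeasE mA) -(mmeasE mSA); apply/eqP; rewrite eq_le; apply/andP; split.
    by apply: (le_measure_full (m := mmeas (X := X)) mSA mA mS C0) => x [[]].
  apply: (le_measure_full (m := mmeas (X := X)) mA mSA mS C0).
  by move=> x [Ax Sx].
have bE x : mm_supp X x -> ball_mass r (f x) = ball_mass r x.
  move=> sx; rewrite /ball_mass -muf; last exact: (@measurable_ball Y (f x) r).
  rewrite -[RHS]full; last exact: (@measurable_ball X x r).
  by congr mm_mu; apply/seteqP; split => y [sy /=]; rewrite isof.
rewrite /conc -muf; last by apply: mm_borel_open; exact: d_open_heavy.
rewrite -[LHS]full; last by apply: mm_borel_open; exact: d_open_heavy.
by congr mm_mu; apply/seteqP; split => x [sx]; rewrite /heavy /= bE.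
Qed.

Lemma conc_parameter X phi r c : mm_parameter X phi ->
  measurable (`[0, 1[ `&` phi @^-1` (@heavy X r c)) /\
  conc X r c = lebesgue_measure (`[0, 1[ `&` phi @^-1` (@heavy X r c)).
Proof.
move=> [mphi phiE]; split.
  by apply: mphi; apply: mm_borel_open; exact: d_open_heavy.
by rewrite phiE//; apply: mm_borel_open; exact: d_open_heavy.
Qed.

Lemma ball_mass_parameter X phi r x : mm_parameter X phi ->
  measurable (`[0, 1[ `&` [set q | mm_d X x (phi q) < r]) /\
  ball_mass r x = lebesgue_measure (`[0, 1[ `&` [set q | (mm_d X x (phi q) < r)%R]).
Proof.
move=> [mphi phiE]; have := @measurable_ball X x r => mB; split; first exact: (mphi _ mB).
exact/esym/(phiE _ mB).
Qed.

Lemma nested_null (A B : set R) : measurable A -> measurable B -> A `<=` B ->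
  B `<=` `[0, 1[ -> lebesgue_measure A = lebesgue_measure B ->
  lebesgue_measure (B `\` A) = 0%E.
Proof.
move=> mA mB AB BU E; rewrite measureD// ?setIidr//.
  rewrite [X in (_ - X)%E](_ : _ = lebesgue_measure B); last exact: E.
  by rewrite subee// leb_fin.
by rewrite -ge0_fin_numE// leb_fin.
Qed.

Lemma bigcup_null (T : countType) (F : T -> set R) :
  (forall q, measurable (F q)) -> (forall q, lebesgue_measure (F q) = 0%E) ->
  lebesgue_measure (\bigcup_q F q) = 0%E.
Proof.
move=> mF F0; pose G n : set R := if @unpickle T n is Some q then F q else set0.
have -> : \bigcup_q F q = \bigcup_n G n.
  apply/seteqP; split => s [q _ Fs]; first by exists (pickle q) => //; rewrite /G pickleK.
  by move: Fs; rewrite /G; case: unpickle => // q' Fs; exists q'.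
have mG n : measurable (G n) by rewrite /G; case: unpickle.
apply: measure_negligible; first exact: bigcupT_measurable.
apply: negligible_bigcup => n; exists (G n); split; [exact: mG| |by []].
by rewrite /G; case: unpickle => [q|]; [exact: F0|exact: measure0].
Qed.

Lemma rat_between (x y : R) : x < y -> exists q : rat, x < ratr q < y.
Proof. by move=> xy; have [q] := rat_in_itvoo xy; rewrite in_itv /=; exists q. Qed.

(** Larger distances make smaller balls, so the heavy sets of [Y] pull back inside those of [X].
    Were all [conc] equal, nested sets of equal mass would give almost every point the same ball
    masses in both spaces, contradicting the strict inequality on [A] and [B]. *)
Lemma conc_strict X Y phi psi (A B : set R) :
  mm_parameter X phi -> mm_parameter Y psi ->
  (forall p q, mm_d X (phi p) (phi q) <= mm_d Y (psi p) (psi q)) ->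
  measurable A -> measurable B -> A `<=` `[0, 1[ -> B `<=` `[0, 1[ ->
  (0 < lebesgue_measure A)%E -> (0 < lebesgue_measure B)%E ->
  (forall p q, A p -> B q -> mm_d X (phi p) (phi q) < mm_d Y (psi p) (psi q)) ->
  exists r c, conc X r c <> conc Y r c.
Proof.
move=> pX pY dle mA mB AU BU A0 B0 dlt; apply: contrapT => ne.
have concE r c : conc X r c = conc Y r c by apply: contrapT => H; apply: ne; exists r, c.
have null := @bigcup_null rat.
have bm_le r p : (ball_mass r (psi p) <= ball_mass r (phi p))%E.
  have [mq ->] := ball_mass_parameter r (psi p) pY.
  have [mq' ->] := ball_mass_parameter r (phi p) pX.
  apply: le_measure; rewrite ?inE//; move=> q [q01 /= pq]; split => //.
  exact: le_lt_trans (dle _ _) pq.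
pose N r c := (`[0, 1[ `&` phi @^-1` (@heavy X r c)) `\` (`[0, 1[ `&` psi @^-1` (@heavy Y r c)).
have N0 r c : measurable (N r c) /\ lebesgue_measure (N r c) = 0%E.
  have [m1 E1] := conc_parameter r c pX; have [m2 E2] := conc_parameter r c pY.
  split; first exact: measurableD.
  apply: (nested_null m2 m1); last by rewrite -E1 -E2.
    by move=> p [p01 pc]; split => //; exact: lt_le_trans pc (bm_le r p).
  exact: subIsetl.
pose NN := \bigcup_(r : rat) \bigcup_(c : rat) N (ratr r) (ratr c).
have mNN : measurable NN.
  apply: countable_bigcupT_measurable; first exact: countableP.
  move=> r; apply: countable_bigcupT_measurable; first exact: countableP.
  by move=> c; case: (N0 (ratr r) (ratr c)).
have NN0 : lebesgue_measure NN = 0%E.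
  apply: (null) => r; last by apply: (null) => c; case: (N0 (ratr r) (ratr c)).
  apply: countable_bigcupT_measurable; first exact: countableP.
  by move=> c; case: (N0 (ratr r) (ratr c)).
(* Restricting to rational [r] and [c] leaves one null set to avoid, so a single [p] in [A] serves
   all radii. *)
have [p [Ap Np]] : exists p, A p /\ ~ NN p.
  apply: contrapT => H; move: A0; apply/negP; rewrite -leNgt -NN0.
  apply: le_measure; rewrite ?inE// => p Ap; apply: contrapT => Np.
  by apply: H; exists p.
have bmE (r : rat) : ball_mass (ratr r) (phi p) = ball_mass (ratr r) (psi p).
  apply/eqP; rewrite eq_le bm_le andbT leNgt; apply/negP => lt.
  have [mq E] := ball_mass_parameter (ratr r) (psi p) pY.
  have [mq' E'] := ball_mass_parameter (ratr r) (phi p) pX.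
  move: lt; rewrite E E'.
  have := leb_fin mq (@subIsetl _ _ _); have := leb_fin mq' (@subIsetl _ _ _).
  move=> /fineK fX /fineK fY; rewrite -fX -fY lte_fin => /rat_between[c /andP[c1 c2]].
  apply: Np; exists r => //; exists c => //; split.
    by split; [exact: AU|rewrite /heavy /= E' -fX lte_fin].
  move=> [_]; rewrite /heavy /= E -fY lte_fin; lra.
have : lebesgue_measure B = 0%E.
  (* For this [p] the two balls of radius [r] differ by a null set, yet each point of [B] lies in
     the difference for a rational [r] between its two distances to [p]. *)
  pose K (r : rat) := (`[0, 1[ `&` [set q | mm_d X (phi p) (phi q) < ratr r]) `\`
     (`[0, 1[ `&` [set q | mm_d Y (psi p) (psi q) < ratr r]).
  have K0 r : measurable (K r) /\ lebesgue_measure (K r) = 0%E.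
    have [m1 E1] := ball_mass_parameter (ratr r) (phi p) pX.
    have [m2 E2] := ball_mass_parameter (ratr r) (psi p) pY.
    split; first exact: measurableD.
    apply: (nested_null m2 m1); last by rewrite -E1 -E2.
      by move=> q [q01 pq]; split => //; exact: le_lt_trans (dle _ _) pq.
    exact: subIsetl.
  apply/eqP; rewrite eq_le measure_ge0 andbT -(null K) => [|r|r]; last 2 first.
  - by case: (K0 r).
  - by case: (K0 r).
  apply: le_measure; rewrite ?inE//.
    apply: countable_bigcupT_measurable; first exact: countableP.
    by move=> r; case: (K0 r).
  move=> q Bq; have [r /andP[r1 r2]] := rat_between (dlt p q Ap Bq).
  by exists r => //; split; [split => //; exact: BU|move=> [_ /=]; lra].
by move=> B00; move: B0; rewrite B00 ltxx.
Qed.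

End ball_mass.

(** * Geodesics *)

Section family.
Context {R : realType}.
Implicit Types X Y : mmspace R.

Lemma mm_iso_refl X : mm_iso X X.
Proof. exact/box_adm0_mm_iso/box_adm_refl. Qed.

(** The optimal good set may be full or empty, whereas the gluing needs a non-empty [S] and a
    remainder of positive mass at most [D]. *)
Lemma good_part_exists X0 X1 (D : R) : 0 < D <= 1 -> box_adm X0 X1 D ->
  exists (phi0 : R -> mm_car X0) (phi1 : R -> mm_car X1) (S : set R),
  [/\ mm_parameter X0 phi0, mm_parameter X1 phi1, measurable S /\ S `<=` `[0, 1[,
      (exists s, S s) /\
      forall s t, S s -> S t -> `|pull_d phi0 phi1 false s t - pull_d phi0 phi1 true s t| <= D
    & 0 < rem_mass S <= D].
Proof.
move=> /andP[D0 D1] [_ [phi0 [phi1 [I0 [p0 p1 [mI IU] leI dis]]]]].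
have mR (A : set R) : measurable A -> measurable (`[0, 1[ `\` A).
  by move=> mA; apply: measurableD => //; exact: measurable_itv.
suff [S [mS SI S0 /andP[rm0 rmD]]] : exists S : set R, [/\ measurable S, S `<=` `[0, 1[,
    S `<=` I0 & 0 < rem_mass S <= D].
  have [[s Ss]|Sn] := pselect (exists s, S s).
    exists phi0, phi1, S; split => //; [|by rewrite rm0].
    by split; [exists s|move=> x y /S0 Ix /S0 Iy; exact: dis].
  (* An empty [S] is replaced by one point, which has no distortion and does not change the mass of
     the remainder. *)
  exists phi0, phi1, [set 0]; split => //.
  - split; first exact: measurable_set1.
    by move=> x ->; rewrite /= in_itv /= lexx ltr01.
  - split; first by exists 0.
    by move=> x y -> ->; rewrite !pull_d_xx subrr normr0 ltW.
  have <- : rem_mass S = rem_mass [set 0]; last by rewrite rm0.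
  have -> : S = set0 by apply/seteqP; split => // x Sx; case: Sn; exists x.
  have E : `[0, 1[ `\` [set 0] = `]0, 1[%classic :> set R.
    apply/seteqP; split => x; rewrite /= !in_itv /=.
      by move=> [/andP[x0 ->] /eqP xn]; rewrite lt_neqAle eq_sym xn x0.
    by move=> /andP[x0 ->]; rewrite ltW//; split => //; apply/eqP; rewrite gt_eqF.
  by rewrite /rem_mass setD0 E !lebesgue_measure_itv.
pose Q : set R := `[0, 1[ `\` I0.
have mQ : measurable Q by exact: mR.
have finQ : lebesgue_measure Q \is a fin_num by apply: leb_fin; [exact: mQ|exact: subDsetl].
have leQ : (lebesgue_measure Q <= D%:E)%E.
  have := prob_add_setC (@lebU_setT R) (mI : @measurable _ (measurableTypeR R) I0).
  rewrite !lebUE -setDE (setIidr IU) -/Q; move: leI finQ.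
  move: (lebesgue_measure I0) (lebesgue_measure Q) => x y.
  case: x => [x||] //; case: y => [y||] // xD _ [xy].
  by move: xD; rewrite !lee_fin; lra.
have [r0|r0] := eqVneq (lebesgue_measure Q) 0%E; last first.
  exists I0; split => //; rewrite -lte_fin -[X in _ && X]lee_fin /rem_mass fineK//.
  by rewrite leQ andbT lt_neqAle eq_sym r0 measure_ge0.
(* When [I0] is full, a piece of mass [D] is given up: the definition of the box distance tolerates
   exactly that much. *)
exists (I0 `&` `[D, 1[); split; [| |exact: subIsetl|].
- by apply: measurableI => //; exact: measurable_itv.
- by move=> x [/IU].
have mD : measurable (`[0, 1[ `\` (I0 `&` `[D, 1[)).
  by apply: mR; apply: measurableI => //; exact: measurable_itv.
have itvD : lebesgue_measure (`[0, D[%classic : set R) = D%:E.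
  by rewrite lebesgue_measure_itv /= lte_fin D0 oppr0 adde0.
rewrite -lte_fin -[X in _ && X]lee_fin /rem_mass fineK; last exact: leb_fin.
apply/andP; split.
  apply: (@lt_le_trans _ _ D%:E); first by rewrite lte_fin.
  rewrite -itvD; apply: le_measure; rewrite ?inE//.
  move=> x; rewrite /= !in_itv /= => /andP[x0 xD]; split.
    by rewrite x0 (lt_le_trans xD).
  by move=> [_]; rewrite leNgt xD.
pose W : set R := `[0, D[%classic.
have mW : measurable W by exact: measurable_itv.
apply: (@le_trans _ _ (lebesgue_measure (W `|` Q))).
  apply: le_measure; rewrite ?inE//; first exact: measurableU.
  move=> x [/= x01 nx]; have [Ix|Ix] := pselect (I0 x); last by right.
  left; move: x01 nx; rewrite /W /= !in_itv /= => /andP[x0 x1] nx; rewrite x0 /= ltNge.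
  by apply/negP => Dx; apply: nx; split => //; rewrite Dx.
have : (lebesgue_measure (W `|` Q) <= lebesgue_measure W + lebesgue_measure Q)%E.
  by apply: measureU2.
by rewrite r0 adde0 itvD.
Qed.

(** The ends are [X0] and [X1] themselves, so that a member can be attached to another path.
    Different members are separated by values of [conc], which also lets a third space be compared
    with two of them. *)
Lemma geodesic_family X0 X1 : ~ mm_iso X0 X1 -> exists gam : R -> R -> mmspace R,
  [/\ forall th, gam th 0 = X0 /\ gam th 1 = X1,
      forall th s t, 2^-1 <= th <= 1 -> 0 <= s <= 1 -> 0 <= t <= 1 ->
        box (gam th s) (gam th t) = `|s - t| * box X0 X1
    & forall th th' t, 2^-1 <= th -> th < th' <= 1 -> 0 < t < 1 ->
        exists r c, conc (gam th t) r c <> conc (gam th' t) r c].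
Proof.
move=> nXY; pose D := box X0 X1.
have D01 : 0 < D <= 1 by rewrite box_gt0// box_le1.
have [phi0 [phi1 [S [p0 p1 [mS SU] [S_ex S_dis] /andP[rm0 rmD]]]]] :=
  good_part_exists D01 (box_adm_inf X0 X1).
have D0 : 0 <= D by exact: box_ge0.
pose good th t X := exists phi, mm_parameter X phi /\
  forall x y, mm_d X (phi x) (phi y) = path_d phi0 phi1 S D th t x y.
have good0 th : good th 0 X0.
  exists phi0; split => // x y.
  by have := path_d_end phi0 phi1 D mS S_ex false th x y; rewrite mulr0n => ->.
have good1 th : good th 1 X1.
  exists phi1; split => // x y.
  by have := path_d_end phi0 phi1 D mS S_ex true th x y; rewrite mulr1n => ->.
have ex (tht : R * R) : exists X, [/\ tht.2 = 0 -> X = X0, tht.2 = 1 -> X = X1 &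
    2^-1 <= tht.1 -> 0 <= tht.2 <= 1 -> good tht.1 tht.2 X].
  case: tht => th t /=.
  have [->|t0] := eqVneq t 0; first by exists X0; split => // /esym/eqP; rewrite oner_eq0.
  have [->|t1] := eqVneq t 1; first by exists X1; split => // /eqP; rewrite oner_eq0.
  have [h|h] := pselect (2^-1 <= th /\ 0 <= t <= 1); last first.
    by exists X0; split => [/eqP|/eqP|h1 h2]; rewrite ?(negbTE t0) ?(negbTE t1)//; case: h.
  have [X [phi Xphi]] := path_space_exists p0 p1 mS S_ex S_dis rm0 rmD h.1 h.2.
  by exists X; split => [/eqP|/eqP|_ _]; rewrite ?(negbTE t0) ?(negbTE t1)//; exists phi.
have [gam gamP] := choice ex.
exists (fun th t => gam (th, t)); split.
- by move=> th; have [/= h0 _ _] := gamP (th, 0); have [/= _ h1 _] := gamP (th, 1); rewrite h0 ?h1.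
- have upper th s t : 2^-1 <= th <= 1 -> 0 <= s <= 1 -> 0 <= t <= 1 ->
      box (gam (th, s)) (gam (th, t)) <= `|s - t| * D.
    move=> th01 s01 t01; have th2 : 2^-1 <= th by case/andP: th01.
    have [_ _ /= /(_ th2 s01)[phi [pphi dphi]]] := gamP (th, s).
    have [_ _ /= /(_ th2 t01)[psi [ppsi dpsi]]] := gamP (th, t).
    apply: box_le; split; first by rewrite mulr_ge0.
    exists phi, psi, (`[0, 1[ `&` [set p | point_tag S s p = point_tag S t p]); split => //.
    + split; last exact: subIsetl.
      by apply: measurableI; [exact: measurable_itv|exact: measurable_tag_agree].
    + by have := tag_agree_mass mS rm0 rmD s01 t01; rewrite lebUE.
    + move=> x y [_ /= tx] [_ /= ty]; rewrite dphi dpsi.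
      exact: (path_d_lip S_ex S_dis rm0 rmD th01 s01 t01 tx ty).
  (* The three pieces from 0 to s, t and 1 have to cover the distance [D] together; upper bounds on
     the outer two leave at least (t - s) D for the middle one. *)
  have lower th s t : 2^-1 <= th <= 1 -> 0 <= s -> s <= t -> t <= 1 ->
      (t - s) * D <= box (gam (th, s)) (gam (th, t)).
    move=> th01 s0 st t1.
    have [/= h0 _ _] := gamP (th, 0); have [/= _ h1 _] := gamP (th, 1).
    have s01 : 0 <= s <= 1 by rewrite s0 (le_trans st).
    have t01 : 0 <= t <= 1 by rewrite t1 (le_trans s0).
    have o01 : 0 <= (0 : R) <= 1 by rewrite lexx ler01.
    have i01 : 0 <= (1 : R) <= 1 by rewrite lexx ler01.
    have := upper th 0 s th01 o01 s01; have := upper th t 1 th01 t01 i01.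
    rewrite h0// h1// sub0r normrN (ger0_norm s0) ler0_norm ?subr_le0// opprB.
    have := box_tri X0 (gam (th, s)) X1; have := box_tri (gam (th, s)) (gam (th, t)) X1.
    rewrite -/D !mulrBl mul1r; lra.
  move=> th s t th01 s01 t01; apply/eqP; rewrite eq_le upper//=.
  move: (s01) (t01) => /andP[s0 s1] /andP[t0 t1].
  have [st|/ltW ts] := leP s t.
    by rewrite ler0_norm ?subr_le0// opprB; exact: lower.
  by rewrite ger0_norm ?subr_ge0// (box_sym (gam (th, s))); exact: lower.
- move=> th th' t th2 /andP[tt' th1] t01.
  have t01' : 0 <= t <= 1 by case/andP: t01 => *; rewrite !ltW.
  have [_ _ /= /(_ th2 t01')[phi [pphi dphi]]] := gamP (th, t).
  have th2' : 2^-1 <= th' by exact: le_trans (ltW tt').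
  have [_ _ /= /(_ th2' t01')[psi [ppsi dpsi]]] := gamP (th', t).
  have [mT mF] := tagged_mass_gt0 mS rm0 t01.
  apply: (conc_strict pphi ppsi _ _ _ _ _ mF mT).
  + by move=> x y; rewrite dphi dpsi; exact: (path_d_le phi0 phi1 rm0 rmD _ _ t01' (ltW tt')).
  + exact: measurable_tagged.
  + exact: measurable_tagged.
  + exact: subIsetl.
  + exact: subIsetl.
  + by move=> x y [_ tx] [_ ty]; rewrite dphi dpsi; exact: (path_d_lt phi0 phi1 rm0 rmD tt' tx ty).
Qed.

Lemma half_unit_uncountable : ~ exists f : {th : R | 2^-1 <= th <= 1} -> nat, injective f.
Proof.
move=> [f finj].
have : countable (`[2^-1, 1]%classic : set R).
  apply/countable_injP.
  exists (fun x => if pselect (2^-1 <= x <= 1) is left h then f (exist _ x h) else 0%N).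
  move=> x y; rewrite !inE /= !in_itv /= => hx hy.
  case: pselect => // hx'; case: pselect => // hy' /finj [].
  by [].
move=> /countable_lebesgue_measure0; rewrite lebesgue_measure_itv /= lte_fin.
have h1 : 2^-1 < 1 :> R by lra.
rewrite h1 => -[]; lra.
Qed.

End family.

(** * Disjoint geodesics and branching *)

Theorem theorem6p4 (R : realType) (X0 X1 : mmspace R) :
  ~ mm_iso X0 X1 ->
  (exists (I : Type) (gam : I -> R -> mmspace R),
      [/\ ~ (exists f : I -> nat, injective f),
          (forall i, box_geodesic X0 X1 (gam i)) &
          (forall i j, i <> j -> geodesics_disjoint (gam i) (gam j))]) /\
  (forall gam : R -> mmspace R, box_geodesic X0 X1 gam ->
      forall t, 0 <= t < 1 -> branches_at X0 X1 gam t).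
Proof.
move=> nXY; split.
  have [gam [ends geo dif]] := geodesic_family nXY.
  exists {th : R | 2^-1 <= th <= 1}, (fun i => gam (sval i)); split.
  - exact: half_unit_uncountable.
  - move=> [th th01] /=; have [e0 e1] := ends th.
    by split; [rewrite e0; exact: mm_iso_refl|split; [rewrite e1; exact: mm_iso_refl|move=> s t; exact: geo]].
  - move=> [th th01] [th' th01'] ne s t s01 t01 /= iso.
    have th_ne : th != th'.
      by apply/eqP => E; apply: ne; exact: eq_exist.
    have s01' : 0 <= s <= 1 by case/andP: s01 => *; rewrite !ltW.
    have t01' : 0 <= t <= 1 by case/andP: t01 => *; rewrite !ltW.
    have o01 : 0 <= (0 : R) <= 1 by rewrite lexx ler01.
    have st : s = t.
      have := geo th 0 s th01 o01 s01'; have := geo th' 0 t th01' o01 t01'.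
      rewrite (ends th).1 (ends th').1 !sub0r !normrN.
      rewrite !ger0_norm; [|by case/andP: s01'|by case/andP: t01'].
      have := box_tri X0 (gam th s) (gam th' t); have := box_tri X0 (gam th' t) (gam th s).
      rewrite (box_sym (gam th' t)) (mm_iso_box0 iso) => h1 h2 h3 h4.
      have D0 : box X0 X1 != 0 by rewrite gt_eqF// box_gt0.
      apply: (mulIf D0); lra.
    subst t; move: (th01) (th01') => /andP[h h1] /andP[h' h1'].
    have [lt|] := ltP th th'.
      have L : th < th' <= 1 by rewrite lt.
      by have [r [c]] := dif th th' s h L s01; apply; exact: mm_iso_conc.
    rewrite le_eqVlt eq_sym (negbTE th_ne) /= => lt.
    have L : th' < th <= 1 by rewrite lt.
    by have [r [c]] := dif th' th s h' L s01; apply; apply/esym; exact: mm_iso_conc.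
move=> gam [g0 [g1 geo]] t /andP[t0 t1].
have t01 : 0 <= t <= 1 by rewrite t0 ltW.
have o01 : 0 <= (0 : R) <= 1 by rewrite lexx ler01.
have i01 : 0 <= (1 : R) <= 1 by rewrite lexx ler01.
have D0 : 0 < box X0 X1 by exact: box_gt0.
have b1 : box (gam t) (gam 1) = (1 - t) * box X0 X1.
  by rewrite geo// ler0_norm ?opprB// subr_le0 ltW.
have nt1 : ~ mm_iso (gam t) (gam 1).
  move=> /mm_iso_box0; rewrite b1 => /eqP; rewrite mulf_eq0 (gt_eqF D0) orbF subr_eq0.
  by rewrite (gt_eqF t1).
have [h [ends hgeo dif]] := geodesic_family nt1.
(* The continuation is a member of the family from [gam t] to [gam 1], reparametrised on [t, 1]. *)
pose br th s := if s <= t then gam s else h th ((s - t) / (1 - t)).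
have u0 : 0 < 1 - t by rewrite subr_gt0.
have rescale s : t <= s -> s <= 1 -> 0 <= (s - t) / (1 - t) <= 1.
  move=> ts s1; rewrite divr_ge0 ?subr_ge0//=; last exact: ltW.
  by rewrite ler_pdivrMr// mul1r lerB.
have brE th s : t <= s -> br th s = h th ((s - t) / (1 - t)).
  rewrite /br le_eqVlt => /orP[/eqP <-|ts].
    by rewrite lexx subrr mul0r (ends th).1.
  by rewrite leNgt ts.
have br_geo th : 2^-1 <= th <= 1 -> box_geodesic X0 X1 (br th).
  move=> th01; split; first by rewrite /br t0.
  split; first by rewrite brE ?ltW// divff ?gt_eqF// (ends th).2.
  have late s s' : t <= s -> s <= 1 -> t <= s' -> s' <= 1 ->
      box (br th s) (br th s') = `|s - s'| * box X0 X1.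
    move=> ts s1 ts' s1'; rewrite !brE// hgeo ?rescale// b1 -mulrBl normrM normfV.
    rewrite (gtr0_norm u0) mulrA divfK ?gt_eqF//; congr (`|_| * _); ring.
  have mixed s s' : 0 <= s -> s <= t -> t <= s' -> s' <= 1 ->
      box (br th s) (br th s') = (s' - s) * box X0 X1.
    move=> s0 st ts' s1'.
    have s01 : 0 <= s <= 1 by rewrite s0 (le_trans st)// ltW.
    have brs : br th s = gam s by rewrite /br st.
    have brt : br th t = gam t by rewrite /br lexx.
    have A1 : box (br th s) (br th t) = (t - s) * box X0 X1.
      by rewrite brs brt geo// ler0_norm ?opprB// subr_le0.
    have A2 : box (br th t) (br th s') = (s' - t) * box X0 X1.
      by rewrite late// ?ltW// ler0_norm ?opprB// subr_le0.
    have A3 : box (br th s') (br th 1) = (1 - s') * box X0 X1.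
      by rewrite late// ?ltW// ler0_norm ?opprB// subr_le0.
    (* Both [br th s] and [br th 1] lie on the original geodesic, so their distance is known; this
       prevents a shortcut across time [t]. *)
    have A4 : box (br th s) (br th 1) = (1 - s) * box X0 X1.
      rewrite brs brE ?ltW// divff ?gt_eqF// (ends th).2 geo// ler0_norm ?opprB// subr_le0.
      by rewrite (le_trans st)// ltW.
    have := box_tri (br th s) (br th t) (br th s').
    have := box_tri (br th s) (br th s') (br th 1).
    rewrite A1 A2 A3 A4 !mulrBl => T1 T2; apply/eqP; rewrite eq_le.
    by apply/andP; split; lra.
  move=> s s' /andP[s0 s1] /andP[s0' s1'].
  have [st|/ltW ts] := leP s t; have [st'|/ltW ts'] := leP s' t.
  - by rewrite /br st st' geo// ?s0 ?s0'.
  - by rewrite mixed// ler0_norm ?opprB// subr_le0 (le_trans st).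
  - by rewrite box_sym mixed// ger0_norm// subr_ge0 (le_trans st').
  - exact: late.
have early th s : 0 <= s <= t -> mm_iso (gam s) (br th s).
  by move=> /andP[_ st]; rewrite /br st; exact: mm_iso_refl.
pose escapes th := forall e : R, 0 < e ->
  exists2 s, t < s < t + e & s <= 1 /\ ~ mm_iso (gam s) (br th s).
have half1 : 2^-1 <= (2^-1 : R) <= 1 by rewrite lexx; lra.
have one1 : 2^-1 <= (1 : R) <= 1 by rewrite lexx andbT; lra.
have [esc|nesc] := pselect (escapes 1).
  by exists (br 1); split => //; [exact: br_geo|exact: early].
have [esc|nesc'] := pselect (escapes 2^-1).
  by exists (br 2^-1); split => //; [exact: br_geo|exact: early].
have stay th : ~ escapes th -> exists2 e, 0 < e & forall s, t < s < t + e -> s <= 1 ->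
    mm_iso (gam s) (br th s).
  move=> /existsNP[e /not_implyP[e0 H]]; exists e => // s ts s1.
  by apply: contrapT => ni; apply: H; exists s.
have [e e0 H] := stay _ nesc; have [e' e0' H'] := stay _ nesc'.
(* If neither continuation leaves [gam] at once, then at a time [s] just after [t] the space [gam s]
   is isomorphic to both, against their different [conc]. Half of the minimum keeps [s] inside both
   windows and strictly before 1. *)
pose m := Num.min (Num.min e e') (1 - t); pose s := t + m / 2.
have m0 : 0 < m by rewrite !lt_min e0 e0'.
have me : m <= e by rewrite /m !ge_min lexx.
have me' : m <= e' by rewrite /m !ge_min lexx orbT.
have m1 : m <= 1 - t by rewrite /m !ge_min lexx !orbT.
have s1 : s < 1 by rewrite /s; lra.
have ts : t < s by rewrite /s; lra.
have I1 := H s ltac:(rewrite /s; apply/andP; split; lra) (ltW s1).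
have I2 := H' s ltac:(rewrite /s; apply/andP; split; lra) (ltW s1).
have u01 : 0 < (s - t) / (1 - t) < 1.
  by rewrite divr_gt0 ?subr_gt0//= ltr_pdivrMr// mul1r ltrD2r.
have lt : 2^-1 < (1 : R) <= 1 by rewrite lexx andbT; lra.
have [r [c]] := dif 2^-1 1 ((s - t) / (1 - t)) (lexx _) lt u01.
case; rewrite -!brE ?ltW//.
by rewrite -(mm_iso_conc r c I1) -(mm_iso_conc r c I2).
Qed.
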